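(* Let $A$ be a unital semisimple commutative Banach algebra and $B$ a unital commutative Banach algebra. Suppose that $S$ is a map from $A$ onto $B$ and that there exists a non-zero complex number $\alpha$ such that $$\sigma_{\pi}(Sf\,Sg-\alpha)\cap\sigma_{\pi}(fg-\alpha)\neq\emptyset$$ holds for every pair $f$ and $g$ in $A$. Then $B$ is semisimple and there exists a homeomorphism $\phi$ from $\mathrm{Ch}(\mathrm{cl}\,B)$ onto $\mathrm{Ch}(\mathrm{cl}\,A)$ such that the equality $$Sf(y)=S1(y)\,f(\phi(y)),\quad y\in\mathrm{Ch}(\mathrm{cl}\,B)$$ holds for every $f\in A$.
   Context: Banach algebras are over $\mathbb{C}$. The peripheral spectrum of $f$ is $\sigma_{\pi}(f)=\{z\in\sigma(f):|z|=\mathrm{r}(f)\}$, where $\sigma(f)$ is the spectrum and $\mathrm{r}(f)$ the spectral radius. $M_A$ is the maximal ideal space of $A$. $\mathrm{cl}\,A$ is the closure, in the supremum norm, of the Gelfand transform $\hat A$ in $C(M_A)$; it is a uniform algebra on $M_A$, i.e. a uniformly closed subalgebra of $C(M_A)$ containing the constants and separating points. If $A$ is semisimple, elements of $A$ are identified with their Gelfand transforms, so that $A\subset\mathrm{cl}\,A\subset C(M_A)$. $\mathrm{Ch}(\mathrm{cl}\,A)\subset M_A$ is the Choquet boundary of $\mathrm{cl}\,A$. $S$ is not assumed to be linear or multiplicative. *)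

(* Defs.v *)
From HB Require Import structures.
From mathcomp Require Import all_boot all_order all_algebra.
From mathcomp Require Import ring_quotient complex.
From mathcomp Require Import all_classical all_reals all_analysis.

Set Implicit Arguments.
Unset Strict Implicit.
Unset Printing Implicit Defensive.

Import Order.TTheory GRing.Theory Num.Theory.
Import numFieldNormedType.Exports.
Import Normc.

Local Open Scope classical_set_scope.
Local Open Scope ring_scope.

(* A join of [CompleteNormedModule] and [ComAlgebra] would have to be declared
   before [Num.NumDomain], so the multiplication is given by a mixin here, and
   the ring structure is put on the alias [alg_of A] of [A].
   [`|1| = 1] is not required: any complete submultiplicative norm is
   equivalent to one with this property, and none of the notions below
   depends on the choice of the norm. *)
HB.mixin Record hasBanachComMul (K : numFieldType) A
    of CompleteNormedModule K A := {
  bone : A;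
  bmul : A -> A -> A;
  bmulA : associative bmul;
  bmulC : commutative bmul;
  bmul1 : left_id bone bmul;
  bmulDl : left_distributive bmul +%R;
  bone_neq0 : bone != 0;
  bscaleAl : forall (a : K) (f g : A), a *: bmul f g = bmul (a *: f) g;
  normr_bmul : forall f g : A, `|bmul f g| <= `|f| * `|g|
}.

#[short(type="comBanachAlgType")]
HB.structure Definition ComBanachAlgebra (K : numFieldType) :=
  {A of CompleteNormedModule K A & hasBanachComMul K A}.

Section alg_of.
Context {K : numFieldType} (A : comBanachAlgType K).

Definition ring_of : Type := A.

HB.instance Definition _ := GRing.Lmodule.on ring_of.
HB.instance Definition _ := GRing.Zmodule_isComNzRing.Build ring_of
  (@bmulA K A) (@bmulC K A) (@bmul1 K A) (@bmulDl K A) (@bone_neq0 K A).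
HB.instance Definition _ :=
  GRing.Lmodule_isLalgebra.Build K ring_of (@bscaleAl K A).
HB.instance Definition _ := GRing.Lalgebra_isComAlgebra.Build K ring_of.

Definition alg_of : comAlgType K := ring_of.

End alg_of.

Section spectrum.
Context {R : realType} {A : comAlgType R[i]}.

Definition invertible (f : A) : Prop := exists g : A, g * f = 1.

Definition spectrum (f : A) : set R[i] := [set z | ~ invertible (f - z%:A)].

Definition spectral_radius (f : A) : R := sup [set normc z | z in spectrum f].

Definition peripheral_spectrum (f : A) : set R[i] :=
  [set z | spectrum f z /\ normc z = spectral_radius f].

End spectrum.

Definition maximal_ideal (A : comNzRingType) (I : {pred A}) : Prop :=
  idealr_closed I /\
  forall J : {pred A}, idealr_closed J -> {subset I <= J} -> {subset J <= I}.

Definition semisimple (R : realType) (A : comAlgType R[i]) : Prop :=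
  forall f : A, (forall I : {pred A}, maximal_ideal I -> f \in I) -> f = 0.

Section maximal_ideal_space.
Context {R : realType} (A : comAlgType R[i]).

(* Maximal ideals are identified with the characters whose kernels they are. *)
Definition characters : set {ptws A -> R[i]^o} :=
  [set x | linear (x : A -> R[i]^o) /\ monoid_morphism (x : A -> R[i])].

(* [set_type] carries the subspace topology, here that of pointwise
   convergence on [A], i.e. the Gelfand topology. *)
Definition maxspace : topologicalType := set_type characters.

Definition gelfand (f : A) : maxspace -> R[i]^o := fun x => set_val x f.

Definition cl : set {uniform maxspace -> R[i]^o} :=
  [set F | continuous (F : maxspace -> R[i]^o)] `&`
  closure (range gelfand : set {uniform maxspace -> R[i]^o}).

End maximal_ideal_space.

Arguments cl {R} A.

Definition extreme_point (R : realType) (V : lmodType R[i])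
    (K : set V) (v : V) : Prop :=
  K v /\ forall (u w : V) (t : R), K u -> K w -> 0 < t < 1 ->
    v = t%:C%C *: u + (1 - t)%:C%C *: w -> u = v /\ w = v.

Section choquet.
Context {R : realType} {X : topologicalType}.
Variable E : set {uniform X -> R[i]^o}.

Definition supnorm (f : X -> R[i]) : R := sup (range (fun x => normc (f x))).

(* The functionals [L] on the space [E] with [L 1 = 1 = ||L||]; as [L 1 = 1],
   only [||L|| <= 1] has to be asked for. *)
Definition state_space : set (set_type E -> R[i]^o) :=
  [set L | [/\ forall (a : R[i]) (f g h : set_type E),
                 (forall x, set_val h x = a * set_val f x + set_val g x) ->
                 L h = a * L f + L g,
               forall h : set_type E, (forall x, set_val h x = 1) -> L h = 1
             & forall h : set_type E, normc (L h) <= supnorm (set_val h)]].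

Definition evaluation (x : X) : set_type E -> R[i]^o := fun h => set_val h x.

Definition Ch : set X := [set x | extreme_point state_space (evaluation x)].

End choquet.

Definition homeomorphism (X Y : topologicalType) (phi : X -> Y) : Prop :=
  continuous phi /\
  exists psi : Y -> X, [/\ continuous psi, cancel phi psi & cancel psi phi].

(* Main.v *)
(* For [x] in the Choquet boundary of [cl A] there are elements of [A] with values
   in the disc [|z - 1/2| <= 1/2], close to [1] at [x], and small wherever
   prescribed functions vanishing at [x] are not: a Hahn-Banach extension of the
   evaluation at [x] to all bounded functions on [M_A] is multiplicative enough,
   by extremality, to produce [g] in [A] with [Re g] large there and small at [x],
   and [1 / (1 + N g)] is the required element.  Conversely the existence of such
   elements forces [x] into the boundary, and the boundary carries all maxima.

   The hypothesis gives [r(Sf Sg - alpha) = r(fg - alpha)], and, by scaling one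
   factor through the surjectivity of [S], [r(Sf Sg) = r(fg)].  Peaking elements
   then yield a bijection between the Choquet boundaries under which
   [|Sf(y)| = |f(phi y)|].  Making [Sf Sg - alpha] as large as possible near [y]
   shows that [Sf(y)] depends only on [f(phi y)], so that only constants remain.
   For a constant [u], the peripheral spectra for the pair
   [1, alpha + (u - alpha) p], with [p] peaking at [phi y], concentrate at
   [u - alpha], and their intersecting means [S1(y) Su(y) = u]. *)

Require Import Defs.
From mathcomp Require Import all_boot all_order all_algebra.
From mathcomp Require Import complex.
From mathcomp Require Import all_classical all_reals all_analysis.
From mathcomp Require Import ring_quotient ring lra.

Set Implicit Arguments.
Unset Strict Implicit.
Unset Printing Implicit Defensive.

Import Order.TTheory GRing.Theory Num.Theory.
Import numFieldNormedType.Exports.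
Import Normc.

Local Open Scope classical_set_scope.
Local Open Scope ring_scope.

(** * The modulus on [R[i]] *)

(** Equality of spectral radii alone cannot give the formula: for [A = B = R[i]] and real [alpha],
    complex conjugation preserves every [|u v - alpha|]. This is why the argument on constants must
    return to the intersecting peripheral spectra.

    The radius of the disc is what lets moduli determine a value: if [|w| = |alpha|] and [e] takes
    values in the disc, then [w e] stays within [|w/2 - alpha| + |alpha|/2] of [alpha], and this
    reaches [2 |alpha|] only for [w = - alpha].

    The foundations use neither holomorphic functions nor measures. Characters come from a
    Gelfand-Mazur theorem proved by averaging resolvents over roots of unity of order [2^m].
    Boundary points are found by shrinking closed sets of characters instead of faces of the state
    space. *)

Section complex_modulus.
Variable R : realType.
Implicit Types z w : R[i].

Lemma normr_normc z : `|z| = (normc z)%:C%C.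
Proof. by rewrite normc_def; case: z. Qed.

Lemma normc_ge0 z : 0 <= normc z.
Proof. by case: z => a b /=; exact: sqrtr_ge0. Qed.

Lemma normcD z w : normc (z + w) <= normc z + normc w.
Proof. exact: le_normcD. Qed.

Lemma normcB z w : normc (z - w) <= normc z + normc w.
Proof. by rewrite -[normc w]normcN; exact: le_normcD. Qed.

Lemma normc_distC z w : normc (z - w) = normc (w - z).
Proof. by rewrite -[LHS]normcN opprB. Qed.

Lemma normcD_rev z w : normc z - normc w <= normc (z + w).
Proof. by rewrite lerBlDr -{1}[z](addrK w); exact: normcB. Qed.

Lemma sqr_normcE z : normc z ^+ 2 = complex.Re z ^+ 2 + complex.Im z ^+ 2.
Proof. by case: z => a b /=; rewrite sqr_sqrtr // addr_ge0 // sqr_ge0. Qed.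

Lemma normc_real (r : R) : normc r%:C%C = `|r|.
Proof. by rewrite /= expr0n addr0 sqrtr_sqr. Qed.

Lemma ler_normcRe z : `|complex.Re z| <= normc z.
Proof.
rewrite -ler_sqr ?nnegrE ?normc_ge0// sqr_normcE real_normK ?num_real//.
by rewrite lerDl sqr_ge0.
Qed.

Lemma ReleNormc z : complex.Re z <= normc z.
Proof. exact: le_trans (ler_norm _) (ler_normcRe z). Qed.

Lemma ler_normcIm z : `|complex.Im z| <= normc z.
Proof.
rewrite -ler_sqr ?nnegrE ?normc_ge0// sqr_normcE real_normK ?num_real//.
by rewrite lerDr sqr_ge0.
Qed.

Lemma normcX z n : normc (z ^+ n) = normc z ^+ n.
Proof. by elim: n => [|n IH]; rewrite ?expr0 ?normc1 // !exprS normcM IH. Qed.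

Lemma normc_eq0 z : (normc z == 0) = (z == 0).
Proof. by apply/eqP/eqP => [/eq0_normc//|->]; rewrite normc0. Qed.

Lemma normc_gt0 z : (0 < normc z) = (z != 0).
Proof. by rewrite lt_def normc_ge0 andbT normc_eq0. Qed.

Lemma ReD z w : complex.Re (z + w) = complex.Re z + complex.Re w.
Proof. by case: z w => ? ? []. Qed.

Lemma ReC (r : R) : complex.Re r%:C%C = r.
Proof. by []. Qed.

Lemma ReN z : complex.Re (- z) = - complex.Re z.
Proof. by case: z. Qed.

Lemma ReB z w : complex.Re (z - w) = complex.Re z - complex.Re w.
Proof. by rewrite ReD ReN. Qed.

Lemma ReZ (r : R) z : complex.Re (r%:C%C * z) = r * complex.Re z.
Proof. by case: z => a b /=; rewrite mul0r subr0. Qed.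

Lemma ImZ (r : R) z : complex.Im (r%:C%C * z) = r * complex.Im z.
Proof. by case: z => a b /=; rewrite mul0r addr0. Qed.

Lemma ImD z w : complex.Im (z + w) = complex.Im z + complex.Im w.
Proof. by case: z w => ? ? []. Qed.

(** The cross term [- 2 r Re z] of [|r - z|^2] is at most 0. *)
Lemma normc_real_sub (r c b : R) z : 0 <= r -> 0 <= complex.Re z -> normc z <= c ->
  0 <= b -> r ^+ 2 + c ^+ 2 <= b ^+ 2 -> normc (r%:C%C - z) <= b.
Proof.
move=> r0 z0 zc b0 rcb; have c0 : 0 <= c by apply: le_trans zc; exact: normc_ge0.
have zc2 : normc z ^+ 2 <= c ^+ 2 by rewrite ler_sqr ?nnegrE ?normc_ge0.
suff : normc (r%:C%C - z) ^+ 2 <= b ^+ 2 by rewrite ler_sqr ?nnegrE ?normc_ge0.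
rewrite sqr_normcE; move: zc2; rewrite sqr_normcE.
by case: z z0 {zc} => x y /= x0; nra.
Qed.

Lemma Im_Re z : complex.Im z = complex.Re (- 'i%C * z).
Proof. by case: z => a b /=; rewrite !oppr0 mul0r mulN1r sub0r opprK. Qed.

Lemma rotation_to_normc z : exists2 w, normc w = 1 & w * z = (normc z)%:C%C.
Proof.
have [->|z0] := eqVneq z 0; first by exists 1; rewrite ?normc1// mulr0 normc0.
exists ((normc z)%:C%C / z); last by rewrite mulfVK.
by rewrite normcM normcV normc_real ger0_norm ?normc_ge0// mulfV// normc_eq0.
Qed.

Lemma eq_of_small_dist z w : (forall e : R, 0 < e -> normc (z - w) <= e) -> z = w.
Proof.
move=> small; apply/eqP; rewrite -subr_eq0 -normc_eq0 eq_le normc_ge0 andbT.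
by apply/ler_addgt0Pl => e /small; rewrite addr0.
Qed.

Lemma nbhs_normcP (z : R[i]^o) (U : set R[i]^o) :
  nbhs z U <-> exists2 e : R, 0 < e & forall w : R[i], normc (w - z) < e -> U w.
Proof.
split=> [/nbhs_ballP[e /= e0 sub]|[e e0 sub]].
  have eE : e = (complex.Re e)%:C%C by rewrite RRe_real// gtr0_real.
  exists (complex.Re e) => [|w wz]; first by rewrite -ltcR -eE.
  by apply: sub; rewrite -ball_normE /= eE normr_normc ltcR normc_distC.
apply/nbhs_ballP; exists e%:C%C => /=; first by rewrite ltcR.
move=> w; rewrite -ball_normE /= normr_normc ltcR normc_distC; exact: sub.
Qed.

Lemma cvg_normcP (T : Type) (F : set_system T) {FF : Filter F} (f : T -> R[i]^o)
    (l : R[i]^o) :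
  f @ F --> l <-> forall e : R, 0 < e -> F [set t | normc (f t - l) < e].
Proof.
split=> [fl e e0|fl U /nbhs_normcP[e e0 sub]].
  by apply: (fl [set w | normc (w - l) < e]); apply/nbhs_normcP; exists e.
by apply: (@filterS _ F _ _ _ _ (fl _ e0)) => t tl; exact: sub.
Qed.

(** The disc is a closed subset of the image of a square under [(a, b) |-> a + i b]. *)
Lemma compact_disc (r : R) : compact [set z : R[i]^o | normc z <= r].
Proof.
have cI : compact (`[- r, r] : set R) by exact: segment_compact.
pose f (p : R * R) : R[i]^o := (p.1 +i* p.2)%C.
have cimg : compact [set f p | p in `[- r, r] `*` `[- r, r]].
  apply: continuous_compact; last exact: compact_setX.
  apply: continuous_subspaceT => -[a b]; apply/cvg_normcP => e e0.
  have e2 : 0 < e / 2 by lra.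
  have n1 : nbhs a (ball a (e/2)) by exact: nbhsx_ballx.
  have n2 : nbhs b (ball b (e/2)) by exact: nbhsx_ballx.
  exists (ball a (e/2), ball b (e/2)) => // -[c d] [/=].
  rewrite -!ball_normE /= => ac bd.
  change (normc (f (c, d) - f (a, b)) < e).
  have -> : f (c, d) - f (a, b) = ((c - a)%:C + 'i * (d - b)%:C)%C.
    apply/eqP; rewrite eq_complex /=.
    by rewrite !(mul0r, mul1r, subr0, addr0, add0r, mulr0, sub0r, oppr0) !eqxx.
  apply: le_lt_trans (normcD _ _) _; rewrite normcM !normc_real.
  have -> : normc 'i%C = 1 :> R by rewrite /= expr0n add0r expr1n sqrtr1.
  by rewrite mul1r (distrC c) (distrC d); lra.
apply: (subclosed_compact _ cimg).
- move=> z /= clz; rewrite /= leNgt; apply/negP => rz.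
  have : nbhs (z : R[i]^o) [set w : R[i]^o | normc (w - z) < normc z - r].
    by apply/nbhs_normcP; exists (normc z - r) => //; rewrite subr_gt0.
  move=> /clz[w [/= wr wz]].
  have := normcD_rev z (w - z); rewrite addrCA subrr addr0; lra.
- move=> z /= zr; exists (complex.Re z, complex.Im z); last by case: z zr.
  rewrite /= !in_itv /= -!ler_norml.
  by split; apply: le_trans zr; rewrite ?ler_normcRe ?ler_normcIm.
Qed.

End complex_modulus.

(** * The Gelfand-Mazur theorem for a seminorm *)

Section gelfand_mazur.
Variables (R : realType) (A : comAlgType R[i]) (q : A -> R).
Hypothesis qD : forall u v, q (u + v) <= q u + q v.
Hypothesis qM : forall u v, q (u * v) <= q u * q v.
Hypothesis qA : forall z u, q (z%:A * u) = normc z * q u.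
Hypothesis q1_gt0 : 0 < q 1.

(** Inverses are taken modulo the null ideal [q = 0], so that no quotient ring has to be formed. *)
Let inverse (u g : A) := q (g * u - 1) = 0.

Let q0 : q 0 = 0.
Proof. by rewrite -(mul0r 0) -[X in X * _](scale0r 1) qA normc0 mul0r. Qed.

Let qN u : q (- u) = q u.
Proof. by rewrite -mulN1r -scaleN1r qA normcN normc1 mul1r. Qed.

Let q_ge0 u : 0 <= q u.
Proof. have := qD u (- u); rewrite subrr q0 qN => ?; lra. Qed.

Let q1_ge1 : 1 <= q 1.
Proof. by rewrite -(ler_pM2l q1_gt0) mulr1 -[X in q X <= _]mulr1. Qed.

Let null_mull u n : q n = 0 -> q (u * n) = 0.
Proof.
by move=> n0; apply/eqP; rewrite eq_le q_ge0 andbT; have := qM u n; rewrite n0 mulr0.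
Qed.

Let null_add m n : q m = 0 -> q n = 0 -> q (m + n) = 0.
Proof.
by move=> m0 n0; apply/eqP; rewrite eq_le q_ge0 andbT; have := qD m n; lra.
Qed.

Let nullN n : q n = 0 -> q (- n) = 0.
Proof. by rewrite qN. Qed.

Let q_add_null u n : q n = 0 -> q (u + n) <= q u.
Proof. by move=> n0; have := qD u n; lra. Qed.

Let qX u n : q (u ^+ n.+1) <= q u ^+ n.+1.
Proof.
elim: n => [|n IH]; first by rewrite !expr1.
rewrite exprS [leRHS]exprS; apply: le_trans (qM _ _) _.
by rewrite ler_wpM2l.
Qed.

(** Modulo the null ideal [f - f' = (z - z') a f f'], and [q] does not see null elements. *)
Lemma resolvent_identity (a f f' : A) (z z' : R[i]) :
  inverse (1 - z%:A * a) f -> inverse (1 - z'%:A * a) f' ->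
  q (f - f') <= normc (z - z') * (q a * q f * q f').
Proof.
move=> fz fz'.
have -> : f - f' = (z - z')%:A * (a * f * f') +
    (f' * (f * (1 - z%:A * a) - 1) - f * (f' * (1 - z'%:A * a) - 1)).
  by rewrite scalerBl; ring.
apply: le_trans (q_add_null _ _) _.
  by apply: null_add; [exact: null_mull|apply: nullN; exact: null_mull].
rewrite qA ler_wpM2l ?normc_ge0//; apply: le_trans (qM _ _) _.
by rewrite ler_wpM2r.
Qed.

(** The resolvent identity bounds [q (f w)] by [2 q (f z)] for [w] near [z]; compactness of the disc
    makes the bound uniform. *)
Lemma resolvent_bounded (a : A) (f : R[i] -> A) (r : R) :
  (forall z, inverse (1 - z%:A * a) (f z)) ->
  exists2 M : R, 0 < M & forall z, normc z <= r -> q (f z) <= M.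
Proof.
move=> fP; have /compact_near_coveringP near_disc := @compact_disc R r.
have := near_disc R (pinfty_nbhs R) (fun M z => q (f z) <= M) _.
case=> [z _|M [Mr bound]].
  (* With this [d], [|w - z| q a q (f z) <= 1/2], so [q (f w) <= q (f z) + q (f w) / 2]. *)
  set d := (2 * (q a + 1) * (q (f z) + 1))^-1.
  have den_gt0 : 0 < 2 * (q a + 1) * (q (f z) + 1).
    by rewrite !mulr_gt0 ?ltr_wpDl.
  have d0 : 0 < d by rewrite invr_gt0.
  exists ([set w : R[i]^o | normc (w - z) < d], [set M | 2 * q (f z) < M]).
    split; first by apply/nbhs_normcP; exists d.
    by exists (2 * q (f z)); split => //; exact: num_real.
  move=> [w M] /= [wz /ltW]; apply: le_trans.
  have := resolvent_identity (fP w) (fP z).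
  have dE : d * (2 * (q a + 1) * (q (f z) + 1)) = 1 by rewrite mulVf// gt_eqF.
  have small : normc (w - z) * (q a * q (f z)) <= 1 / 2.
    apply: (@le_trans _ _ (d * ((q a + 1) * (q (f z) + 1)))); last by lra.
    apply: ler_pM (ltW wz) _; rewrite ?normc_ge0 ?mulr_ge0//.
    by apply: ler_pM => //; rewrite lerDl.
  have := qD (f w - f z) (f z); rewrite subrK => le1 le2.
  have : normc (w - z) * (q a * q (f w) * q (f z)) <= 1 / 2 * q (f w).
    rewrite (_ : _ * _ = normc (w - z) * (q a * q (f z)) * q (f w)); last by ring.
    by rewrite ler_wpM2r.
  by lra.
exists (Num.max 1 (M + 1)); first by rewrite lt_max ltr01.
move=> z zr; apply: (@le_trans _ _ (M + 1)); last by rewrite le_max lexx orbT.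
by apply: (bound (M + 1)) => //; rewrite ltrDl.
Qed.

(** In this form the comparison of the resolvents at [w] and [s w] survives the squaring of [r], [s]
    and [b] with the same [e]. *)
Let resolvents_close (e r : R) (s : R[i]) (b : A) := forall w, normc w = r ->
  exists g g', [/\ inverse (1 - w%:A * b) g,
                   inverse (1 - (s * w)%:A * b) g' & q (g - g') <= e].

(* [1 / (1 - t^2)] is the mean of [1 / (1 - t)] and [1 / (1 + t)]. *)
Let inverse_square (b g h : A) (w : R[i]) :
  inverse (1 - w%:A * b) g -> inverse (1 - (- w)%:A * b) h ->
  inverse (1 - (w ^+ 2)%:A * b ^+ 2) (2^-1%:A * (g + h)).
Proof.
move=> gP hP; rewrite /inverse.
have half : 2^-1%:A + 2^-1%:A = 1 :> A.
  by rewrite -scalerDl [X in X%:A](_ : _ = 1) ?scale1r//; field.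
have -> : 2^-1%:A * (g + h) * (1 - (w ^+ 2)%:A * b ^+ 2) - 1 =
    2^-1%:A * (1 + w%:A * b) * (g * (1 - w%:A * b) - 1) +
    2^-1%:A * (1 - w%:A * b) * (h * (1 - (- w)%:A * b) - 1).
  rewrite scaleNr (_ : (w ^+ 2)%:A = w%:A ^+ 2 :> A); last first.
    by rewrite !expr2 -scalerAl mul1r scalerA.
  rewrite -[X in _ - X]half; ring.
by apply: null_add; exact: null_mull.
Qed.

(** Each [w] on the new circle is some [v^2]. The mean of the inverses at [v] and [- v] is an
    inverse at [w], and taking means does not increase distances. *)
Lemma resolvents_close_square e r s b : 0 <= r ->
  resolvents_close e r s b -> resolvents_close e (r ^+ 2) (s ^+ 2) (b ^+ 2).
Proof.
move=> r0 close w wr; have [v vw] : exists v, v ^+ 2 = w.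
  by exists (sqrtc w); exact: sqr_sqrtc.
have vr : normc v = r.
  apply/eqP; rewrite -(@eqrXn2 _ 2)// ?normc_ge0//.
  by rewrite -normcX vw wr.
have [g [g' [gv g'v gg']]] := close _ vr.
have [h [h' [hv h'v hh']]] := close (- v) (etrans (normcN v) vr).
exists (2^-1%:A * (g + h)), (2^-1%:A * (g' + h')); split.
- by rewrite -vw; exact: inverse_square.
- rewrite -vw -exprMn; apply: inverse_square => //.
  by rewrite -[- (s * v)]mulrN.
rewrite -mulrBr qA.
have -> : normc (2^-1 : R[i]) = 2^-1.
  have -> : (2^-1 : R[i]) = (2^-1 : R)%:C%C by rewrite fmorphV rmorph_nat.
  by rewrite normc_real ger0_norm.
have -> : g + h - (g' + h') = (g - g') + (h - h') by ring.
by have := qD (g - g') (h - h'); lra.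
Qed.

Lemma resolvents_close_pow2 e r s b m : 0 <= r ->
  resolvents_close e r s b ->
  resolvents_close e (r ^+ (2 ^ m)) (s ^+ (2 ^ m)) (b ^+ (2 ^ m)).
Proof.
move=> r0 close; elim: m => [|m IH]; first by rewrite !expr1.
rewrite expnSr !exprM; apply: resolvents_close_square => //.
by rewrite exprn_ge0.
Qed.

(** By submultiplicativity this expresses that the spectral radius of [r a] with respect to [q] is
    below 1, without a limit. *)
Let powers_vanish (r : R) (a : A) := exists m, q ((r%:C%C%:A * a) ^+ (2 ^ m)) <= 2^-1.

Let scale_exp (z : R[i]) (a : A) n : (z%:A * a) ^+ n = (z ^+ n)%:A * a ^+ n.
Proof. by rewrite -scalerAl mul1r exprZn -scalerAl mul1r. Qed.

(** For a high power [t] of [r a], [1 / (1 - t)] is close to 1. So is [1 / (1 - t')] for the same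
    power [t'] of [s r a], because the error [e] does not grow with the power; hence [t'] is
    small. *)
Lemma powers_vanish_step e r s a : 0 <= r -> 0 <= s ->
  e <= (8 * q 1)^-1 -> resolvents_close e r s%:C%C a ->
  powers_vanish r a -> powers_vanish (s * r) a.
Proof.
move=> r0 s0 e_small close [m small].
(* The thresholds give, for [Q = q 1]: [q g <= 2 Q], then [q (g - 1) <= 1 / (8 Q)], then
   [q (g' - 1) <= 1 / (4 Q)], and at last [q t' <= 1/4 + q t' / 4]. *)
have [k half_k] : exists k, (2^-1 : R) ^+ (2 ^ k) <= (16 * q 1 ^+ 2)^-1.
  have [k kP] : exists k : nat, 16 * q 1 ^+ 2 <= k%:R.
    have /archi_boundP/ltW := ltW (mulr_gt0 (ltr0Sn R 15) (exprn_gt0 2 q1_gt0)).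
    by exists (Num.bound (16 * q 1 ^+ 2)).
  exists k; rewrite exprVn lef_pV2 ?posrE ?exprn_gt0 ?mulr_gt0 ?exprn_gt0//.
  apply: le_trans kP _; rewrite -natrX ler_nat.
  exact: leq_trans (ltnW (ltn_expl _ _)) (ltnW (ltn_expl _ _)).
have [//|g [g' [gP g'P gg']]] :=
  @resolvents_close_pow2 _ _ _ _ (m + k) r0 close (r%:C%C ^+ (2 ^ (m + k))).
  by rewrite normcX normc_real ger0_norm.
rewrite -exprMn -!scale_exp -rmorphM/= in gP g'P.
exists (m + k)%N; move: gP g'P.
set t := (r%:C%C%:A * a) ^+ _; set t' := ((s * r)%:C%C%:A * a) ^+ _ => gP g'P.
have qt : q t <= (16 * q 1 ^+ 2)^-1.
  rewrite /t expnD exprM; apply: le_trans half_k.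
  have [n ->] : exists n, (2 ^ k = n.+1)%N by exists (2 ^ k).-1; rewrite prednK// expn_gt0.
  by apply: le_trans (qX _ _) _; apply: lerXn2r; rewrite ?nnegrE.
have inv16 : (16 * q 1 ^+ 2)^-1 * (16 * q 1 ^+ 2) = 1.
  by rewrite mulVf// gt_eqF// mulr_gt0// exprn_gt0.
have inv8 : (8 * q 1)^-1 * (8 * q 1) = 1 by rewrite mulVf// gt_eqF// mulr_gt0.
set i16 := (16 * q 1 ^+ 2)^-1 in qt inv16; set i8 := (8 * q 1)^-1 in inv8 e_small.
have g1 : q (g - 1) <= q g * q t.
  have -> : g - 1 = g * t + (g * (1 - t) - 1) by ring.
  exact: le_trans (q_add_null _ gP) (qM _ _).
have gb : q g <= q 1 + q (g - 1) by have := qD 1 (g - 1); rewrite addrC subrK.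
have gt' : q t' <= q (g' - 1) * (q 1 + q t').
  have -> : t' = (g' - 1) * (1 - t') - (g' * (1 - t') - 1) by ring.
  apply: le_trans (q_add_null _ (nullN g'P)) _.
  apply: le_trans (qM _ _) _; rewrite ler_wpM2l//.
  have -> : (g' - 1) * (1 - t') - (g' * (1 - t') - 1) = t' by ring.
  by have := qD 1 (- t'); rewrite qN.
have g'1 : q (g' - 1) <= e + q (g - 1).
  have -> : g' - 1 = (g' - g) + (g - 1) by ring.
  by apply: le_trans (qD _ _) _; rewrite lerD2r -qN opprB.
have i16_ge0 : 0 <= i16 by rewrite invr_ge0 mulr_ge0// exprn_ge0// ltW.
have := q_ge0 t; have := q_ge0 t'; have := q_ge0 g; have := q_ge0 (g' - 1).
move: i16 i8 i16_ge0 e_small (q 1) (q t) (q t') (q g) (q (g' - 1)) (q (g - 1))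
  q1_ge1 qt inv16 inv8 g1 gb gt' g'1.
move=> i16 i8 i16_ge0 e_small Q T T' G K L Q1 Ti i16E i8E LGT GQL T'K KeL K0 G0 T'0 T0.
have i16_le : i16 <= 16^-1.
  have : 0 <= i16 * (Q ^+ 2 - 1) by rewrite mulr_ge0// subr_ge0 exprn_ege1.
  lra.
have G2 : G <= 2 * Q.
  have : 0 <= G * (16^-1 - T) by rewrite mulr_ge0//; lra.
  lra.
have L_le : L <= i8.
  have : L <= 2 * Q * i16 by apply: le_trans LGT _; exact: ler_pM.
  suff -> : i8 = 2 * Q * i16 by [].
  have Q8 : 8 * Q != 0 by rewrite gt_eqF//; lra.
  by apply: (mulIf Q8); rewrite i8E -[LHS]i16E; ring.
have KQ : K * Q <= 4^-1.
  have : 0 <= (2 * i8 - K) * Q by rewrite mulr_ge0//; lra.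
  lra.
have : 0 <= K * (Q - 1) by rewrite mulr_ge0//; lra.
have : 0 <= T' * (4^-1 - K) by rewrite mulr_ge0//; nra.
lra.
Qed.

(** This replaces Liouville's theorem. If every [a - z] had an inverse modulo the null ideal, the
    resolvents would be bounded on a disc of radius [r], and [powers_vanish] would spread from a
    small radius to [r]. With [b] inverse to [a], the element [(b a)^n], which is 1 modulo the null
    ideal, is the product of [(b / r)^n] and [(r a)^n], of seminorms at most 1 and 1/2; but
    [q 1 >= 1]. *)
Theorem gelfand_mazur (a : A) : exists z : R[i], forall g, q (g * (a - z%:A) - 1) != 0.
Proof.
apply: contrapT => no; have inv z : exists g, q (g * (a - z%:A) - 1) = 0.
  apply: contrapT => noz; apply: no; exists z => g; apply/eqP => gz.
  by apply: noz; exists g.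
have [b] := inv 0; rewrite scale0r subr0 => bP.
have resolvent z : exists g, inverse (1 - z%:A * a) g.
  have [->|z0] := eqVneq z 0.
    by exists 1; rewrite /inverse scale0r mul0r subr0 mulr1 subrr.
  have [g gz] := inv z^-1; exists (- (z^-1)%:A * g); rewrite /inverse.
  have zz : z^-1%:A * z%:A = 1 :> A by rewrite -scalerAl mul1r scalerA mulVf// scale1r.
  have -> : - z^-1%:A * g * (1 - z%:A * a) - 1 =
      (z^-1%:A * z%:A) * (g * a) - z^-1%:A * g - 1 by ring.
  by rewrite zz mul1r [_ * g]mulrC -mulrBr.
have [f fP] : exists f, forall z, inverse (1 - z%:A * a) (f z).
  by exists (fun z => projT1 (cid (resolvent z))) => z; case: cid.
(* This choice gives [q (b / r) <= 1]. *)
set r := q b + 1; have r0 : 0 < r by rewrite ltr_wpDl.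
have [M M0 fM] := resolvent_bounded r fP.
set e := (8 * q 1)^-1; have e0 : 0 < e by rewrite invr_gt0 mulr_gt0.
have rqa0 : 0 <= r * q a by rewrite mulr_ge0// ltW.
have rqaM0 : 0 <= r * q a * M ^+ 2 / e.
  by rewrite mulr_ge0 ?invr_ge0 ?(ltW e0)// mulr_ge0 ?exprn_ge0// ltW.
(* The radius will grow in steps of [d = r / (J + 1)]. The first summand makes [q (d a) <= 1/2],
   where the growth starts; the second makes resolvents at points of distance [d] differ by at most
   [e]. *)
have [J JP] : exists J : nat, r * q a * 2 + r * q a * M ^+ 2 / e <= J.+1%:R.
  have : 0 <= r * q a * 2 + r * q a * M ^+ 2 / e by lra.
  move=> /archi_boundP/ltW le; eexists; apply: le_trans le _.
  by rewrite ler_nat.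
have J0 : 0 < J.+1%:R :> R by [].
set d := r / J.+1%:R; have d0 : 0 < d by rewrite divr_gt0.
have rdJ : r = d * J.+1%:R by rewrite divfK// gt_eqF.
have da : d * q a * 2 <= 1.
  rewrite -(ler_pM2r J0) mul1r.
  apply: le_trans JP.
  suff -> : d * q a * 2 * J.+1%:R = r * q a * 2 by lra.
  by rewrite rdJ; ring.
have dM : d * (q a * M ^+ 2) <= e.
  rewrite -(ler_pM2r J0) -ler_pdivrMl//; apply: le_trans JP.
  suff -> : e^-1 * (d * (q a * M ^+ 2) * J.+1%:R) = r * q a * M ^+ 2 / e by lra.
  by rewrite rdJ; ring.
(* The ratio [s = (j + 2) / (j + 1)] moves each point of the circle of radius [d (j + 1)] by exactly
   [d]. *)
have vanish j : (j <= J)%N -> powers_vanish (d * j.+1%:R) a.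
  elim: j => [_|j IH jJ].
    exists 0%N; rewrite mulr1 expr1 qA normc_real ger0_norm; last exact: ltW.
    lra.
  have j0 : 0 < j.+1%:R :> R by [].
  have -> : d * j.+2%:R = j.+2%:R / j.+1%:R * (d * j.+1%:R) by field; rewrite gt_eqF.
  apply: (@powers_vanish_step e) => //; [| |exact/IH/ltnW].
    by rewrite mulr_ge0// ltW.
  move=> w wd; have swE : normc ((j.+2%:R / j.+1%:R)%:C%C * w) = d * j.+2%:R.
    by rewrite normcM normc_real wd ger0_norm ?divr_ge0//; field; rewrite gt_eqF.
  have le_r k : (k <= J)%N -> d * k.+1%:R <= r.
    by move=> kJ; rewrite rdJ ler_wpM2l ?ler_nat// ltW.
  exists (f w), (f ((j.+2%:R / j.+1%:R)%:C%C * w)); split => //.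
  apply: le_trans (resolvent_identity (fP _) (fP _)) _; apply: le_trans dM.
  have -> : normc (w - (j.+2%:R / j.+1%:R)%:C%C * w) = d.
    rewrite -{1}[w]mul1r -mulrBl -[1]/(1%:C%C) -rmorphB/= normcM normc_real wd.
    have -> : 1 - j.+2%:R / j.+1%:R = - j.+1%:R^-1 :> R.
      by rewrite (_ : j.+2%:R = j.+1%:R + 1 :> R) ?natr1//; field; rewrite gt_eqF.
    by rewrite normrN ger0_norm ?invr_ge0//; field; rewrite gt_eqF.
  rewrite ler_wpM2l ?(ltW d0)// -mulrA ler_wpM2l// expr2; apply: ler_pM => //.
    by apply: fM; rewrite wd; apply: le_r; exact: ltnW.
  by apply: fM; rewrite swE; exact: le_r.
have [m] := vanish J (leqnn J); rewrite -rdJ; set n := (2 ^ m)%N => small.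
have bn : q ((b * a) ^+ n - 1) = 0.
  elim: n {small} => [|n IH]; first by rewrite expr0 subrr.
  have -> : (b * a) ^+ n.+1 - 1 = (b * a) ^+ n * (b * a - 1) + ((b * a) ^+ n - 1).
    by rewrite exprSr; ring.
  by apply: null_add => //; exact: null_mull.
have : q 1 <= q ((b * a) ^+ n).
  have {1}-> : 1 = (b * a) ^+ n - ((b * a) ^+ n - 1) by ring.
  exact/q_add_null/nullN.
have -> : (b * a) ^+ n = ((r^-1)%:C%C%:A * b) ^+ n * (r%:C%C%:A * a) ^+ n.
  rewrite -!exprMn; congr (_ ^+ _).
  rewrite -!scalerAl !mul1r -scalerAr scalerA -rmorphM/= mulVf ?scale1r//.
  by rewrite gt_eqF.
have nE : exists k, n = k.+1 by exists n.-1; rewrite prednK// expn_gt0.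
have : q (((r^-1)%:C%C%:A * b) ^+ n) <= 1.
  case: nE => k ->; apply: le_trans (qX _ _) _; apply: exprn_ile1 => //.
  rewrite qA normc_real ger0_norm ?invr_ge0 ?(ltW r0)// mulrC ler_pdivrMr//.
  by rewrite mul1r lerDl.
have := qM (((r^-1)%:C%C%:A * b) ^+ n) ((r%:C%C%:A * a) ^+ n).
have := q_ge0 ((r%:C%C%:A * a) ^+ n); have := q_ge0 (((r^-1)%:C%C%:A * b) ^+ n).
move: small q1_ge1; move: (q 1) (q _) (q _) (q _) => ? ? ? ?; nra.
Qed.

End gelfand_mazur.

(** * Maximal ideals and the Gelfand transform *)

Section gelfand_transform.
Variables (R : realType) (A : comAlgType R[i]).
Implicit Types (f g : A) (x : maxspace A) (z : R[i]).

Lemma gelfand_linear x : linear (fun f => gelfand f x : R[i]^o).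
Proof. by have [] := set_valP x. Qed.

Lemma gelfandD f g x : gelfand (f + g) x = gelfand f x + gelfand g x.
Proof. by have := gelfand_linear x 1 f g; rewrite !scale1r. Qed.

Lemma gelfand0 x : gelfand (0 : A) x = 0.
Proof. by have := gelfandD 0 0 x; rewrite addr0 -{1}[gelfand 0 x]addr0 => /addrI. Qed.

Lemma gelfandZ z f x : gelfand (z *: f) x = z * gelfand f x.
Proof. by have := gelfand_linear x z f 0; rewrite gelfand0 !addr0. Qed.

Lemma gelfandN f x : gelfand (- f) x = - gelfand f x.
Proof. by rewrite -scaleN1r gelfandZ mulN1r. Qed.

Lemma gelfandB f g x : gelfand (f - g) x = gelfand f x - gelfand g x.
Proof. by rewrite gelfandD gelfandN. Qed.

Lemma gelfandM f g x : gelfand (f * g) x = gelfand f x * gelfand g x.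
Proof. by have [_ [_ xM]] := set_valP x; exact: xM. Qed.

Lemma gelfand1 x : gelfand (1 : A) x = 1.
Proof. by have [_ []] := set_valP x. Qed.

Lemma gelfandA z x : gelfand (z%:A : A) x = z.
Proof. by rewrite gelfandZ gelfand1 mulr1. Qed.

Definition gelfandE :=
  (gelfandD, gelfandB, gelfandN, gelfandM, gelfandA, gelfand1, gelfand0, gelfandZ).

Lemma gelfand_inj x y : (forall f, gelfand f x = gelfand f y) -> x = y.
Proof. by move=> xy; apply: val_inj; apply: funext. Qed.

Lemma gelfand_continuous f : continuous (gelfand f : maxspace A -> R[i]^o).
Proof.
move=> x; apply: (continuous_comp (f := set_val) (g := fun h : {ptws A -> R[i]^o} => h f)).
  exact: initial_continuous.
exact: proj_continuous.
Qed.

Lemma nbhs_gelfand f x (e : R) : 0 < e ->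
  nbhs x [set y | normc (gelfand f y - gelfand f x) < e].
Proof. by move=> e0; have /cvg_normcP := @gelfand_continuous f x; exact. Qed.

Lemma cvg_maxspace (F : set_system (maxspace A)) {FF : Filter F} x :
  (forall f, gelfand f @ F --> (gelfand f x : R[i]^o)) -> F --> x.
Proof.
move=> Fx U [_ [[V oV <-] Vx VU]].
have FV : (set_val @ F) --> (set_val x : {ptws A -> R[i]^o}).
  apply/cvg_sup => f W [_ [[B oB <-] Bx BW]].
  have /Fx : nbhs (gelfand f x : R[i]^o) B by exact: open_nbhs_nbhs.
  by apply: (@filterS _ F) => y By; apply: BW.
have /FV : nbhs (set_val x : {ptws A -> R[i]^o}) V by exact: open_nbhs_nbhs.
by apply: (@filterS _ F) => y Vy; apply: VU.
Qed.

Lemma gelfand_in_spectrum f x : spectrum f (gelfand f x).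
Proof.
move=> [g gf]; have := gelfandM g (f - (gelfand f x)%:A) x.
by rewrite gf gelfand1 gelfandB gelfandA subrr mulr0 => /eqP; rewrite oner_eq0.
Qed.

End gelfand_transform.

(* Completeness of the norm matters below only through these two properties. *)
Definition gelfand_algebra (R : realType) (A : comAlgType R[i]) : Prop :=
  compact [set: maxspace A] /\
  forall (f : A) z, spectrum f z -> exists x, gelfand f x = z.

(** * The norm and the Neumann series *)

Section banach.
Variables (R : realType) (B : comBanachAlgType R[i]).
Let A := alg_of B.
Implicit Types f g : A.

(** The norm of a normed module over [R[i]] has its values in [R[i]]; they are real, so the real
    part loses nothing. *)
Definition bnorm f : R := complex.Re (`|f : B|).

Lemma bnormE f : `|f : B| = (bnorm f)%:C%C.
Proof. by rewrite /bnorm RRe_real// ger0_real. Qed.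

Lemma bnorm_ge0 f : 0 <= bnorm f.
Proof. by rewrite -ler0c -bnormE; exact: normr_ge0. Qed.

Lemma bnormD f g : bnorm (f + g) <= bnorm f + bnorm g.
Proof. by rewrite -lecR rmorphD/= -!bnormE; exact: ler_normD. Qed.

Lemma bnormM f g : bnorm (f * g) <= bnorm f * bnorm g.
Proof. by rewrite -lecR rmorphM/= -!bnormE; exact: (@normr_bmul _ B). Qed.

Lemma bnormZ z f : bnorm (z *: f) = normc z * bnorm f.
Proof. by apply: complexI; rewrite rmorphM/= -!bnormE -normr_normc; exact: normrZ. Qed.

Lemma bnormN f : bnorm (- f) = bnorm f.
Proof. by rewrite -scaleN1r bnormZ normcN normc1 mul1r. Qed.

Lemma bnorm_eq0 f : bnorm f = 0 -> f = 0.
Proof. by move=> f0; apply: (@normr0_eq0 _ B); rewrite bnormE f0. Qed.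

(** The factor [bnorm 1] is there already at [n = 0], where the norm of 1 may exceed 1. *)
Lemma bnormX_le f n : bnorm (f ^+ n) <= bnorm 1 * bnorm f ^+ n.
Proof.
elim: n => [|n IH]; first by rewrite !expr0 mulr1.
rewrite exprSr; apply: le_trans (bnormM _ _) _.
by rewrite exprSr mulrA ler_wpM2r ?bnorm_ge0.
Qed.

(** The partial sums of the Neumann series are Cauchy, and by completeness they have a limit, which
    inverts [1 - u]. *)
Lemma invertible_near1 u : bnorm u < 1 -> invertible (1 - u : A).
Proof.
move=> u1; set r := bnorm u in u1; have r0 : 0 <= r by exact: bnorm_ge0.
have r1 : 0 < 1 - r by rewrite subr_gt0.
pose s n : A := \sum_(k < n) u ^+ k.
have sM n : s n * (1 - u) = 1 - u ^+ n.
  elim: n => [|n IH]; first by rewrite /s big_ord0 mul0r expr0 subrr.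
  by rewrite /s big_ord_recr/= mulrDl -/(s n) IH exprSr; ring.
have tail n m : bnorm (s (n + m)%N - s n) <= bnorm 1 * r ^+ n * (1 - r)^-1.
  have tail' : bnorm (s (n + m)%N - s n) * (1 - r) <= bnorm 1 * r ^+ n * (1 - r ^+ m).
    elim: m => [|m IH].
      by rewrite addn0 !subrr (_ : bnorm 0 = 0) ?mul0r ?mulr0// /bnorm normr0.
    rewrite addnS /s big_ord_recr/= -!/(s _) addrAC.
    have := bnormD (s (n + m)%N - s n) (u ^+ (n + m)).
    have := bnormX_le u (n + m); rewrite -/r [r ^+ (n + m)]exprD [r ^+ m.+1]exprSr.
    move: IH r1; set b := bnorm _; set c := bnorm (u ^+ _); set d := bnorm (_ + _).
    move=> IH r1 cle dle.
    have : d * (1 - r) <= (b + c) * (1 - r) by rewrite ler_wpM2r// ltW.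
    have : c * (1 - r) <= bnorm 1 * (r ^+ n * r ^+ m) * (1 - r) by rewrite ler_wpM2r// ltW.
    lra.
  rewrite ler_pdivlMr//; apply: le_trans tail' _; rewrite ler_piMr//.
    by rewrite mulr_ge0 ?bnorm_ge0 ?exprn_ge0.
  by rewrite gerBl exprn_ge0.
have rn0 (e : R) : 0 < e -> exists n, bnorm 1 * r ^+ n * (1 - r)^-1 < e.
  move=> e0; have := cvg_expr (_ : `|r| < 1); rewrite ger0_norm// => /(_ u1) cvg0.
  have d0 : 0 < e * (1 - r) / (bnorm 1 + 1).
    by rewrite divr_gt0 ?mulr_gt0// ltr_wpDl ?bnorm_ge0.
  have /cvgrPdist_lt/(_ _ d0)[n _ /(_ n (leqnn n))] := cvg0.
  rewrite sub0r normrN ger0_norm ?exprn_ge0// => rn; exists n.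
  rewrite ltr_pdivrMr//; move: rn; rewrite ltr_pdivlMr ?ltr_wpDl ?bnorm_ge0//.
  have := exprn_ge0 n r0; nra.
have cs : cvg ((s : nat -> B) @ \oo).
  apply: cauchy_cvg; apply: cauchy_exP => e e0.
  have eE : e = (complex.Re e)%:C%C by rewrite RRe_real// gtr0_real.
  have [|n ne] := rn0 (complex.Re e); first by rewrite -ltcR -eE.
  exists (s n); exists n => // m /= nm; rewrite -ball_normE /=.
  rewrite (distrC (s n : B)) eE (bnormE (s m - s n)) ltcR -(subnKC nm).
  exact: le_lt_trans (tail _ _) ne.
have [l sl] : exists l : B, (s : nat -> B) @ \oo --> l by exists (lim ((s : nat -> B) @ \oo)).
exists (l : A); apply/eqP; rewrite -subr_eq0; apply/eqP/bnorm_eq0/eqP.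
rewrite eq_le bnorm_ge0 andbT; apply/ler_addgt0Pl => e e0; rewrite addr0.
pose d := e / (bnorm (1 - u) + 1 + (1 - r)).
have den0 : 0 < bnorm (1 - u) + 1 + (1 - r) by have := bnorm_ge0 (1 - u); lra.
have d0 : 0 < d by rewrite divr_gt0.
have dc : 0 < d%:C%C by rewrite ltcR.
have [n nd] := rn0 _ d0.
have /cvgrPdist_lt/(_ _ dc)[N _ NP] := sl.
have := NP (n + N)%N (leq_addl _ _) => /=.
rewrite (bnormE ((l : A) - s (n + N)%N)) ltcR => lsd.
have -> : (l : A) * (1 - u) - 1 = ((l : A) - s (n + N)%N) * (1 - u) - u ^+ (n + N).
  have := sM (n + N)%N; rewrite mulrBl => ->; ring.
have un : bnorm (u ^+ (n + N)) <= d * (1 - r).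
  apply: le_trans (bnormX_le _ _) _; rewrite -ler_pdivrMr//; apply: le_trans (ltW nd).
  rewrite ler_wpM2r ?invr_ge0 ?(ltW r1)// ler_wpM2l ?bnorm_ge0//.
  by rewrite exprD ler_piMr ?exprn_ge0// exprn_ile1// ltW.
apply: le_trans (bnormD _ _) _; rewrite bnormN.
have : bnorm (((l : A) - s (n + N)%N) * (1 - u)) <= d * bnorm (1 - u).
  apply: le_trans (bnormM _ _) _; rewrite ler_wpM2r ?bnorm_ge0//; exact: ltW.
have : d * (bnorm (1 - u) + 1 + (1 - r)) = e.
  by rewrite divfK// gt_eqF.
lra.
Qed.

End banach.

(** * Existence of maximal ideals *)

Section ideals.
Variable A : comNzRingType.

(** Zorn's lemma for unions of chains speaks of sets, [idealr_closed] of boolean predicates; this is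
    the counterpart for sets. *)
Definition proper_ideal_set (J : set A) : Prop :=
  [/\ J 0, ~ J 1 & forall a u v, J u -> J v -> J (a * u + v)].

Definition set_pred (J : set A) : {pred A} := fun u => `[< J u >].

Lemma set_predP (J : set A) u : reflect (J u) (u \in set_pred J).
Proof. exact: asboolP. Qed.

Lemma proper_ideal_setP (J : set A) : proper_ideal_set J <-> idealr_closed (set_pred J).
Proof.
split=> [[J0 J1 JD]|[/set_predP J0 /set_predP J1 JD]].
  split; [exact/set_predP|exact/set_predP|].
  by move=> a u v /set_predP Ju /set_predP Jv; apply/set_predP/JD.
split=> // a u v Ju Jv.
by apply/set_predP/JD; exact/set_predP.
Qed.

Lemma exists_maximal_ideal (f : A) : (forall g, g * f != 1) ->
  exists2 I : {pred A}, maximal_ideal I & f \in I.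
Proof.
move=> nf; pose fA := [set a * f | a in setT].
(* The multiples of [f] are adjoined to [X] instead of being required inside it, so that the union
   of the empty chain qualifies as well. *)
have [|J [PJ Jmax]] := @Zorn_bigcup A (fun X => proper_ideal_set (X `|` fA)).
  move=> F FP Ftot; split.
  - by right; exists 0 => //; rewrite mul0r.
  - case=> [[X FX X1]|[a _ af]]; last by have := nf a; rewrite af eqxx.
    by have [_ + _] := FP _ FX; apply; left.
  - have key X a u v : F X -> (X `|` fA) u -> (X `|` fA) v ->
        (\bigcup_(X in F) X `|` fA) (a * u + v).
      by move=> FX Xu Xv; have [_ _ /(_ a _ _ Xu Xv)[Xw|?]] := FP _ FX; [left; exists X|right].
    move=> a u v [[X FX Xu]|fu] [[Y FY Yv]|fv].
    + have [XY|YX] := Ftot _ _ FX FY.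
        by apply: (key Y) => //; left => //; exact: XY.
      by apply: (key X) => //; left => //; exact: YX.
    + by apply: (key X) => //; [left|right].
    + by apply: (key Y) => //; [right|left].
    + by move: fu fv => [b _ <-] [c _ <-]; right; exists (a * b + c) => //; rewrite mulrDl mulrA.
exists (set_pred (J `|` fA)); last by apply/set_predP; right; exists 1; rewrite ?mul1r.
split=> [|K KI JK u Ku]; first exact/proper_ideal_setP.
apply: contrapT => Ju; have KE : [set v | v \in K] `|` fA = [set v | v \in K].
  apply/seteqP; split=> [v [//|fv]|v Kv]; last by left.
  by apply: JK; apply/set_predP; right.
apply: (Jmax [set v | v \in K]).
  split=> [v Jv|/(_ u Ku) Ju']; last by apply: Ju; apply/set_predP; left.
  by apply: JK; apply/set_predP; left.
have [K0 K1 KD] := KI.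
by rewrite KE; split; [exact: K0|exact/negP|move=> a u' v; exact: KD].
Qed.

End ideals.

(** * The quotient by a maximal ideal is the field of scalars *)

Section maximal_ideals_banach.
Variables (R : realType) (B : comBanachAlgType R[i]).
Let A := alg_of B.
Variable I : {pred A}.
Hypothesis maxI : maximal_ideal I.
Implicit Types f g : A.

Let ideal_I : idealr_closed I. Proof. by case: maxI. Qed.
Let I0 : 0 \in I. Proof. by case: ideal_I. Qed.
Let ID u v : u \in I -> v \in I -> u + v \in I.
Proof. by case: ideal_I => _ _ cl Iu Iv; have := cl 1 u v Iu Iv; rewrite mul1r. Qed.
Let IM a u : u \in I -> a * u \in I.
Proof. by case: ideal_I => _ _ cl Iu; have := cl a u 0 Iu I0; rewrite addr0. Qed.

Definition quotient_norm f : R := inf [set bnorm (f + i) | i in [set i | i \in I]].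

Let q_has f : has_inf [set bnorm (f + i) | i in [set i | i \in I]].
Proof.
split; first by exists (bnorm (f + 0)); exists 0.
by exists 0 => _ [i _ <-]; exact: bnorm_ge0.
Qed.

Let q_le f i : i \in I -> quotient_norm f <= bnorm (f + i).
Proof. by move=> Ii; apply: ge_inf; [case: (q_has f)|exists i]. Qed.

Let q_ge f c : (forall i, i \in I -> c <= bnorm (f + i)) -> c <= quotient_norm f.
Proof.
move=> cf; apply: lb_le_inf; first by case: (q_has f).
by move=> _ [i Ii <-]; exact: cf.
Qed.

Let q_approx f e : 0 < e -> exists2 i, i \in I & bnorm (f + i) < quotient_norm f + e.
Proof.
by move=> e0; have [_ [i Ii <-] lt] := inf_adherent e0 (q_has f); exists i.
Qed.

Let qD f g : quotient_norm (f + g) <= quotient_norm f + quotient_norm g.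
Proof.
apply/ler_addgt0Pl => e e0; have e2 : 0 < e / 2 by rewrite divr_gt0.
have [i Ii fi] := q_approx f e2; have [j Ij gj] := q_approx g e2.
apply: le_trans (q_le _ (ID Ii Ij)) _.
have -> : f + g + (i + j) = (f + i) + (g + j) by ring.
by apply: le_trans (bnormD _ _) _; lra.
Qed.

Let q_ge0 f : 0 <= quotient_norm f.
Proof. by apply: q_ge => i _; exact: bnorm_ge0. Qed.

Let qM f g : quotient_norm (f * g) <= quotient_norm f * quotient_norm g.
Proof.
apply/ler_addgt0Pl => e e0.
pose d := Num.min 1 (e / (quotient_norm f + quotient_norm g + 1)).
have den0 : 0 < quotient_norm f + quotient_norm g + 1 by have := q_ge0 f; have := q_ge0 g; lra.
have d0 : 0 < d by rewrite lt_min ltr01 divr_gt0.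
have d1 : d <= 1 by rewrite ge_min lexx.
have de : d * (quotient_norm f + quotient_norm g + 1) <= e.
  by rewrite -ler_pdivlMr// ge_min lexx orbT.
have [i Ii fi] := q_approx f d0; have [j Ij gj] := q_approx g d0.
have Ik : f * j + g * i + i * j \in I by rewrite ?ID ?IM.
apply: le_trans (q_le _ Ik) _.
have -> : f * g + (f * j + g * i + i * j) = (f + i) * (g + j) by ring.
apply: le_trans (bnormM _ _) _.
have := bnorm_ge0 (f + i); have := bnorm_ge0 (g + j).
have : bnorm (f + i) * bnorm (g + j) <= (quotient_norm f + d) * (quotient_norm g + d).
  by apply: ler_pM; rewrite ?bnorm_ge0// ltW.
have : 0 <= d * (1 - d) by rewrite mulr_ge0// ?subr_ge0// ltW.
lra.
Qed.

Let qZ_le z f : quotient_norm (z%:A * f) <= normc z * quotient_norm f.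
Proof.
have [->|z0] := eqVneq z 0.
  rewrite scale0r mul0r normc0 mul0r; apply: le_trans (q_le _ I0) _.
  by rewrite addr0 /bnorm normr0.
rewrite [leRHS]mulrC -ler_pdivrMr ?normc_gt0//; apply: q_ge => i Ii.
rewrite ler_pdivrMr ?normc_gt0// [leRHS]mulrC -bnormZ.
apply: le_trans (q_le _ (IM z%:A Ii)) _.
by rewrite -mulrDr -scalerAl mul1r.
Qed.

Let qA z f : quotient_norm (z%:A * f) = normc z * quotient_norm f.
Proof.
have [->|z0] := eqVneq z 0.
  apply/eqP; rewrite eq_le qZ_le normc0 mul0r; exact: q_ge0.
apply/eqP; rewrite eq_le qZ_le andTb -ler_pdivlMl ?normc_gt0// -normcV.
apply: le_trans (qZ_le _ _).
by rewrite -!scalerAl !mul1r scalerA mulVf// scale1r.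
Qed.

Let q_null f : f \in I -> quotient_norm f = 0.
Proof.
move=> If; apply/eqP; rewrite eq_le q_ge0 andbT.
have INf : - f \in I by rewrite -mulN1r IM.
by apply: le_trans (q_le _ INf) _; rewrite subrr /bnorm normr0.
Qed.

Let unit_notin f : invertible f -> f \notin I.
Proof.
by move=> [g gf]; apply/negP => /(IM g); rewrite gf; apply/negP; case: ideal_I.
Qed.

(** An [i] in the ideal with [|1 + i| < 1] would make [- i = 1 - (1 + i)] invertible. This takes the
    place of closedness of the ideal. *)
Let q1_gt0 : 0 < quotient_norm 1.
Proof.
apply: lt_le_trans ltr01 _; apply: q_ge => i Ii; rewrite leNgt; apply/negP => i1.
have INi : - i \in I by rewrite -mulN1r IM.
move: (unit_notin (invertible_near1 i1)).
by rewrite (_ : 1 - (1 + i) = - i) ?INi//; ring.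
Qed.

(** An element [f - z] without inverse modulo the null ideal of the quotient seminorm has none
    modulo [I]. So [f - z] and [I] generate a proper ideal, and maximality puts [f - z] into [I]. *)
Let scalar_mod f : exists z, f - z%:A \in I.
Proof.
have [z fz] := gelfand_mazur qD qM qA q1_gt0 f; exists z.
pose J := [set u : A | exists a i, i \in I /\ u = a * (f - z%:A) + i].
have [I0' I1 Icl] := ideal_I.
have J1 : ~ J 1.
  move=> [a [i [Ii fi]]]; have /eqP := fz a; apply; apply: q_null.
  have -> : a * (f - z%:A) - 1 = - i by rewrite [X in _ - X]fi; ring.
  by rewrite -mulN1r IM.
have JI : proper_ideal_set J.
  split=> // [|a _ _ [b [i [Ii ->]]] [c [j [Ij ->]]]].
    by exists 0, 0; rewrite mul0r addr0.
  by exists (a * b + c), (a * i + j); split; [exact: Icl|ring].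
case: maxI => _ /(_ (set_pred J) ((proper_ideal_setP J).1 JI)); apply.
  by move=> i Ii; apply/set_predP; exists 0, i; rewrite mul0r add0r.
by apply/set_predP; exists 1, 0; rewrite mul1r addr0.
Qed.

Let value f : R[i] := projT1 (cid (scalar_mod f)).
Let valueP f : f - (value f)%:A \in I. Proof. by rewrite /value; case: cid. Qed.

Let value_unique f z : f - z%:A \in I -> value f = z.
Proof.
move=> fz; apply/eqP; rewrite -subr_eq0; apply: contraT => w0.
have : (value f - z)%:A \in I.
  have -> : (value f - z)%:A = (f - z%:A) + (-1) * (f - (value f)%:A).
    by rewrite scalerBl; ring.
  by rewrite ID ?IM ?valueP.
apply: contraTT => _; apply: unit_notin; exists ((value f - z)^-1)%:A.
by rewrite -scalerAl mul1r scalerA mulVf// scale1r.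
Qed.

(** A proper ideal contains no non-zero scalar, so the scalar congruent to [f] is unique, and
    uniqueness makes it linear and multiplicative in [f]. *)
Lemma maximal_ideal_character :
  exists x : maxspace A, forall f, gelfand f x = 0 <-> f \in I.
Proof.
have vlin : linear (value : A -> R[i]^o).
  move=> a f g; apply: value_unique.
  have -> : a *: f + g - (a *: value f + value g : R[i])%:A =
      a%:A * (f - (value f)%:A) + (g - (value g)%:A).
    by rewrite scalerDl -scalerAl mul1r scalerBr scalerA; ring.
  by rewrite ID ?IM ?valueP.
have vmul : monoid_morphism (value : A -> R[i]).
  split=> [|f g]; apply: value_unique; first by rewrite scale1r subrr.
  have -> : f * g - (value f * value g)%:A =
      g * (f - (value f)%:A) + (value f)%:A * (g - (value g)%:A).
    have -> : (value f * value g)%:A = (value f)%:A * (value g)%:A :> A.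
      by rewrite -scalerAl mul1r scalerA.
    ring.
  by rewrite ID ?IM ?valueP.
have xP : characters (value : {ptws A -> R[i]^o}) by split.
exists (SigSub (mem_set xP)) => f; rewrite /gelfand; change (value f = 0 <-> f \in I).
split=> [f0|If].
  by have := valueP f; rewrite f0 scale0r subr0.
by apply: value_unique; rewrite scale0r subr0.
Qed.

End maximal_ideals_banach.

(** * Spectrum, compactness of the maximal ideal space, semisimplicity *)

Section banach_gelfand.
Variables (R : realType) (B : comBanachAlgType R[i]).
Let A := alg_of B.
Implicit Types f g : A.

Lemma spectrum_gelfand f z : spectrum f z -> exists x, gelfand f x = z.
Proof.
move=> fz; have [|I maxI fI] := @exists_maximal_ideal A (f - z%:A).
  by move=> g; apply/eqP => gf; apply: fz; exists g.
have [x xP] := maximal_ideal_character maxI; exists x.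
by apply/eqP; rewrite -subr_eq0 -[X in _ - X](gelfandA (A := A) z x) -gelfandB; apply/eqP/xP.
Qed.

(** Otherwise [1 - f / f(x)] would be invertible by the Neumann series, although it vanishes at
    [x]. *)
Lemma gelfand_le_norm f x : normc (gelfand f x) <= bnorm f.
Proof.
rewrite leNgt; apply/negP => fx; set z := gelfand f x in fx.
have z0 : z != 0 by rewrite -normc_gt0; apply: le_lt_trans fx; exact: bnorm_ge0.
have [|g gP] := @invertible_near1 R B (z^-1 *: f).
  by rewrite bnormZ normcV mulrC ltr_pdivrMr ?normc_gt0// mul1r.
have := gelfandM g (1 - z^-1 *: f) x; rewrite gP gelfand1 gelfandB gelfandZ gelfand1 -/z.
by rewrite mulVf// subrr mulr0 => /eqP; rewrite oner_eq0.
Qed.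

(** Along an ultrafilter each transform converges, being confined to a disc; the limits form a
    character, to which the ultrafilter converges. *)
Lemma compact_maxspace : compact [set: maxspace A].
Proof.
rewrite compact_ultra => F FU _; have FP := ultra_proper (F := F).
have FF : Filter F by exact: filter_filter.
have limF f : exists l : R[i], forall e : R, 0 < e -> F [set x | normc (gelfand f x - l) < e].
  have [|l [_ cl]] := @compact_disc R (bnorm f) (gelfand f @ F) _.
    suff : F [set x | normc (gelfand f x) <= bnorm f] by [].
    by apply: filterS filterT => x _; exact: gelfand_le_norm.
  exists l => e e0; have [//|FC] := in_ultra_setVsetC [set x | normc (gelfand f x - l) < e] FU.
  have nl : nbhs l [set z : R[i]^o | normc (z - l) < e] by apply/nbhs_normcP; exists e.
  have FC' : (gelfand f @ F) [set z : R[i]^o | ~ normc (z - l) < e] by exact: FC.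
  by have [z []] := cl _ _ FC' nl.
pose l f : R[i] := projT1 (cid (limF f)).
have lP f (e : R) : 0 < e -> F [set x | normc (gelfand f x - l f) < e].
  by rewrite /l; case: cid => w /= fw; exact: fw.
have unique f z : (forall e : R, 0 < e -> F [set x | normc (gelfand f x - z) < e]) -> l f = z.
  move=> fz; apply: eq_of_small_dist => e e0; have e2 : 0 < e / 2 by lra.
  have [x /= [lx zx]] := filter_ex (filterI (lP f _ e2) (fz _ e2)).
  have -> : l f - z = (gelfand f x - z) - (gelfand f x - l f) by ring.
  by have := normcB (gelfand f x - z) (gelfand f x - l f); lra.
have llin : linear (l : A -> R[i]^o).
  move=> a f g; apply: unique => e e0.
  have d0 : 0 < e / (normc a + 1) by rewrite divr_gt0// ltr_wpDl// normc_ge0.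
  have := @filterI _ F FF _ _ (lP f _ d0) (lP g _ d0); apply: (@filterS _ F FF) => x [/= fx gx].
  have -> : gelfand (a *: f + g) x - (a *: (l f : R[i]^o) + l g) =
      a * (gelfand f x - l f) + (gelfand g x - l g).
    by rewrite gelfandD gelfandZ; change (a *: (l f : R[i]^o)) with (a * l f); ring.
  apply: le_lt_trans (normcD _ _) _; rewrite normcM.
  have dE : e / (normc a + 1) * (normc a + 1) = e by rewrite divfK// gt_eqF// ltr_wpDl// normc_ge0.
  have := normc_ge0 a; nra.
have lmul : monoid_morphism (l : A -> R[i]).
  split=> [|f g]; apply: unique => e e0.
    by apply: filterS filterT => x _ /=; rewrite gelfand1 subrr normc0.
  have f0 := normc_ge0 (l f); have g0 := normc_ge0 (l g).
  pose c := normc (l f) + normc (l g) + 1; have c0 : 0 < c by rewrite /c; lra.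
  pose d := Num.min 1 (e / c); have d0 : 0 < d by rewrite lt_min ltr01 divr_gt0.
  have d1 : d <= 1 by rewrite ge_min lexx.
  have de : d * c <= e by rewrite -ler_pdivlMr// ge_min lexx orbT.
  have := @filterI _ F FF _ _ (lP f _ d0) (lP g _ d0); apply: (@filterS _ F FF) => x [/= fx gx].
  have -> : gelfand (f * g) x - l f * l g =
      (gelfand f x - l f) * (gelfand g x - l g) + l f * (gelfand g x - l g) +
      l g * (gelfand f x - l f).
    by rewrite gelfandM; ring.
  apply: le_lt_trans (normcD _ _) _; rewrite normcM.
  have := normcD ((gelfand f x - l f) * (gelfand g x - l g)) (l f * (gelfand g x - l g)).
  rewrite !normcM; set X := normc (_ + _); set a := normc (gelfand f x - l f) in fx *.
  set b := normc (gelfand g x - l g) in gx * => Xle.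
  have b0 : 0 <= b by exact: normc_ge0.
  have : 0 <= (1 - a) * b by rewrite mulr_ge0//; lra.
  have : 0 <= normc (l f) * (d - b) by rewrite mulr_ge0//; lra.
  have : 0 <= normc (l g) * (d - a) by rewrite mulr_ge0//; lra.
  by move: de; rewrite /c; lra.
have xP : characters (l : {ptws A -> R[i]^o}) by split.
exists (SigSub (mem_set xP)); split => //; apply: cvg_maxspace => f.
by apply/cvg_normcP => e; exact: lP.
Qed.

Lemma banach_gelfand_algebra : gelfand_algebra A.
Proof. by split; [exact: compact_maxspace|exact: spectrum_gelfand]. Qed.

(** The maximal ideals are exactly the kernels of characters. *)
Lemma semisimpleP : semisimple A <->
  forall f, (forall x : maxspace A, gelfand f x = 0) -> f = 0.
Proof.
split=> [ss f f0|inj f fI].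
  apply: ss => I maxI; have [x xP] := maximal_ideal_character maxI.
  exact/(xP f).1/f0.
apply: inj => x; pose I : {pred A} := fun g => gelfand g x == 0.
apply/eqP/(fI I); split=> [|J JI IJ g Jg].
  split; rewrite ?unfold_in /I ?gelfand0 ?gelfand1 ?oner_eq0//.
  move=> a u v; rewrite !unfold_in /I => /eqP u0 /eqP v0.
  by rewrite gelfandD gelfandM u0 v0 mulr0 addr0.
rewrite unfold_in /I; apply: contraT => g0; case: JI => J0 J1 Jcl; move: J1; apply: contraNT => _.
(* An ideal that contains the kernel of [x] and an element [g] outside of it contains 1, since
   [1 - g / g(x)] lies in the kernel. *)
have Ih : 1 - (gelfand g x)^-1 *: g \in I.
  by rewrite unfold_in /I gelfandB gelfand1 gelfandZ mulVf// subrr.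
have -> : 1 = ((gelfand g x)^-1)%:A * g + (1 - (gelfand g x)^-1 *: g) :> A.
  by rewrite -scalerAl mul1r; ring.
by apply: Jcl => //; exact: IJ.
Qed.

End banach_gelfand.

(** * The Hahn-Banach theorem *)

Section hahn_banach.
Variables (R : realType) (V : lmodType R) (D : set V).
Hypothesis DD : forall u v, D u -> D v -> D (u + v).
Hypothesis DZ : forall (t : R) u, D u -> D (t *: u).

Let DN u : D u -> D (- u). Proof. by move=> Du; rewrite -scaleN1r; exact: DZ. Qed.

Definition sublinear (p : V -> R) : Prop :=
  (forall u v, D u -> D v -> p (u + v) <= p u + p v) /\
  (forall t u, 0 < t -> D u -> p (t *: u) = t * p u).

Let sublinear0 p u : sublinear p -> D u -> p 0 = 0.
Proof.
move=> [_ pZ] /(DZ 0); rewrite scale0r => D0.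
by have := pZ 2 0 (ltr0Sn R 1) D0; rewrite scaler0; lra.
Qed.

Let sublinearN p u : sublinear p -> D u -> - p (- u) <= p u.
Proof.
move=> sp Du; have := sp.1 u (- u) Du (DN Du).
by rewrite subrr (sublinear0 sp Du); lra.
Qed.

Let shrink_set (p : V -> R) v u := [set p (u + t *: v) - t * p v | t in [set t | 0 <= t]].

(** This lowers [p] along the ray of [v]: the result stays sublinear and is at most [- p v] at
    [- v]. The value 0 off [D] is a convention that lets functionals be compared at every vector. *)
Let shrink p v u := if `[< D u >] then inf (shrink_set p v u) else 0.

Let shrink_has p v u : sublinear p -> D v -> D u -> has_inf (shrink_set p v u).
Proof.
move=> sp Dv Du; split; first by exists (p (u + 0 *: v) - 0 * p v); exists 0 => /=.
exists (- p (- u)) => _ [t /= t0 <-].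
have pt : p (t *: v) = t * p v.
  have [->|tn0] := eqVneq t 0; first by rewrite scale0r mul0r (sublinear0 sp Du).
  by apply: sp.2 => //; rewrite lt_def tn0.
have := sp.1 (u + t *: v) (- u) (DD Du (DZ t Dv)) (DN Du).
by rewrite addrAC subrr add0r pt; lra.
Qed.

Let shrink_le p v u t : sublinear p -> D v -> D u -> 0 <= t ->
  shrink p v u <= p (u + t *: v) - t * p v.
Proof.
move=> sp Dv Du t0; rewrite /shrink asboolT//; apply: ge_inf; last by exists t.
by case: (shrink_has sp Dv Du).
Qed.

Let shrink_ge p v u c : sublinear p -> D v -> D u ->
  (forall t, 0 <= t -> c <= p (u + t *: v) - t * p v) -> c <= shrink p v u.
Proof.
move=> sp Dv Du cle; rewrite /shrink asboolT//; apply: lb_le_inf.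
  by case: (shrink_has sp Dv Du).
by move=> _ [t t0 <-]; exact: cle.
Qed.

Let shrink_sublinear p v : sublinear p -> D v -> sublinear (shrink p v).
Proof.
move=> sp Dv; split=> [u w Du Dw|s u s0 Du].
  rewrite -lerBlDr; apply: shrink_ge => // t t0.
  rewrite lerBlDr -lerBlDl; apply: shrink_ge => // r r0.
  rewrite lerBlDl; apply: le_trans (shrink_le sp Dv (DD Du Dw) (addr_ge0 t0 r0)) _.
  have := sp.1 (u + t *: v) (w + r *: v) (DD Du (DZ t Dv)) (DD Dw (DZ r Dv)).
  by rewrite addrACA -scalerDl; lra.
have le s' u' : 0 < s' -> D u' -> s' * shrink p v u' <= shrink p v (s' *: u').
  move=> s'0 Du'; apply: shrink_ge => //; first exact: DZ.
  move=> t t0; have := shrink_le sp Dv Du' (divr_ge0 t0 (ltW s'0)).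
  rewrite -(ler_pM2l s'0) mulrBr -(sp.2 _ _ s'0 (DD Du' (DZ _ Dv))).
  have st : s' * (t / s') = t by rewrite mulrCA divff ?gt_eqF// mulr1.
  by rewrite scalerDr scalerA [X in _ - X]mulrA st.
apply/eqP; rewrite eq_le le// andbT.
have := le s^-1 (s *: u); rewrite invr_gt0 => /(_ s0 (DZ s Du)).
by rewrite scalerA mulVf ?gt_eqF// scale1r mulrC ler_pdivrMr// mulrC.
Qed.

Let shrink_le_self p v u : sublinear p -> D v -> D u -> shrink p v u <= p u.
Proof.
by move=> sp Dv Du; have := shrink_le sp Dv Du (lexx 0); rewrite scale0r addr0 mul0r subr0.
Qed.

(** A minimal sublinear functional [p] below [q] is unchanged by [shrink] along every [v]; at
    [t = 1] this reads [p u + p v <= p (u + v)], so [p] is additive. *)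
Theorem hahn_banach (q : V -> R) (u0 : V) : sublinear q -> D u0 ->
  exists L : V -> R,
    [/\ forall u v, D u -> D v -> L (u + v) = L u + L v,
        forall t u, D u -> L (t *: u) = t * L u,
        forall u, D u -> L u <= q u & L u0 = q u0].
Proof.
move=> sq Du0.
(* The bound at [- u0], provided by a first shrinking of [q] along [u0], is what forces the final
   functional to reach [q] at [u0]. *)
pose good (p : V -> R) := [/\ sublinear p, forall u, D u -> p u <= q u,
  forall u, ~ D u -> p u = 0 & p (- u0) <= - q u0].
have good_shrink p v : good p -> D v -> good (shrink p v).
  move=> [sp pq pD pu0] Dv; split.
  - exact: shrink_sublinear.
  - by move=> u Du; apply: le_trans (pq _ Du); exact: shrink_le_self.
  - by move=> u nDu; rewrite /shrink asboolF.
  - by apply: le_trans pu0; apply: shrink_le_self => //; exact: DN.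
have good0 : good (shrink q u0).
  split; first exact: shrink_sublinear.
  - by move=> u Du; exact: shrink_le_self.
  - by move=> u nDu; rewrite /shrink asboolF.
  - have := shrink_le sq Du0 (DN Du0) ler01.
    by rewrite scale1r addNr (sublinear0 sq Du0) mul1r sub0r.
pose T := {p : V -> R | good p}.
(* The order is reversed, so that a maximal element is a minimal functional. *)
pose below : rel T := fun p p' => `[< forall u, sval p' u <= sval p u >].
have [||| F Ftot|[p gp] pmin] := @Zorn T below.
- by move=> p; apply/asboolP.
- move=> p1 p2 p3 /asboolP p12 /asboolP p23; apply/asboolP => u.
  exact: le_trans (p23 u) (p12 u).
- move=> [p gp] [p' gp'] /asboolP /= pp' /asboolP /= p'p; apply: eq_exist.
  by apply: funext => u; apply/eqP; rewrite eq_le pp' p'p.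
- have [[p0 Fp0]|F0] := pselect (exists p0, F p0); last first.
    exists (exist _ _ good0) => p Fp; exfalso; apply: F0; by exists p.
  pose values u := [set sval p u | p in F].
  pose m u := inf (values u).
  have lower u p : D u -> F p -> - q (- u) <= sval p u.
    case: p => p [sp pq _ _] /= Du _.
    have := sublinearN sp Du; have := pq _ (DN Du); lra.
  have m_has u : D u -> has_inf (values u).
    move=> Du; split; first by exists (sval p0 u); exists p0.
    by exists (- q (- u)) => _ [p Fp <-]; exact: lower.
  have m_le u p : D u -> F p -> m u <= sval p u.
    by move=> Du Fp; apply: ge_inf; [case: (m_has _ Du)|exists p].
  have m_ge u c : D u -> (forall p, F p -> c <= sval p u) -> c <= m u.
    move=> Du cle; apply: lb_le_inf; first by case: (m_has _ Du).
    by move=> _ [p Fp <-]; exact: cle.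
  have mD u : ~ D u -> m u = 0.
    move=> nDu; rewrite /m (_ : values u = [set 0]) ?inf1//.
    apply/seteqP; split=> [_ [[p [_ _ p0D _]] _ <-]/=|_ ->]; first exact: p0D.
    by exists p0 => //; have [_ _ p0D _] := svalP p0; exact: p0D.
  have gm : good m.
    split=> //; [split| |].
    + move=> u v Du Dv; rewrite -lerBlDr; apply: (m_ge _ _ Du) => p Fp.
      rewrite lerBlDr -lerBlDl; apply: (m_ge _ _ Dv) => p' Fp'; rewrite lerBlDl.
      have key r : F r -> sval r u <= sval p u -> sval r v <= sval p' v ->
          m (u + v) <= sval p u + sval p' v.
        move=> Fr ru rv; apply: le_trans (m_le _ _ (DD Du Dv) Fr) _.
        case: r Fr ru rv => r [sr _ _ _] /= _ ru rv.
        have := sr.1 u v Du Dv; lra.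
      by have [/asboolP p'p|/asboolP pp'] := Ftot _ _ Fp Fp'; [apply: (key p')|apply: (key p)].
    + have le s u : 0 < s -> D u -> s * m u <= m (s *: u).
        move=> s0 Du; apply: (m_ge _ _ (DZ s Du)) => p Fp.
        have [sp _ _ _] := svalP p; have := m_le _ _ Du Fp; rewrite sp.2//.
        by rewrite ler_pM2l.
      move=> s u s0 Du; apply/eqP; rewrite eq_le le// andbT.
      have := le s^-1 (s *: u); rewrite invr_gt0 => /(_ s0 (DZ s Du)).
      by rewrite scalerA mulVf ?gt_eqF// scale1r mulrC ler_pdivrMr// mulrC.
    + move=> u Du; apply: le_trans (m_le _ _ Du Fp0) _.
      by have [_ pq _ _] := svalP p0; exact: pq.
    + apply: le_trans (m_le _ _ (DN Du0) Fp0) _.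
      by have [_ _ _] := svalP p0.
  exists (exist _ m gm) => p Fp; apply/asboolP => u /=.
  have [Du|nDu] := pselect (D u); first exact: m_le.
  by have [_ _ p0D _] := svalP p; rewrite mD// p0D.
have [sp pq pD pu0] := gp.
have pshrink v : D v -> shrink p v = p.
  move=> Dv; have gs := good_shrink _ _ gp Dv.
  suff : exist _ _ gs = exist _ _ gp :> T by case.
  apply: pmin; apply/asboolP => u /=; have [Du|nDu] := pselect (D u).
    exact: shrink_le_self.
  by rewrite /shrink asboolF// pD.
have pDD u v : D u -> D v -> p (u + v) = p u + p v.
  move=> Du Dv; apply/eqP; rewrite eq_le sp.1//=.
  have := shrink_le sp Dv Du ler01; rewrite pshrink// scale1r mul1r; lra.
have pN u : D u -> p (- u) = - p u.
  move=> Du; have := pDD u (- u) Du (DN Du).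
  by rewrite subrr (sublinear0 sp Du); lra.
exists p; split => //.
  move=> t u Du; have [t0|t0|->] := ltgtP t 0.
  - rewrite -[t]opprK scaleNr pN; last exact: DZ.
    by rewrite sp.2 ?oppr_gt0// !mulNr.
  - exact: sp.2.
  - by rewrite scale0r mul0r (sublinear0 sp Du).
by apply/eqP; rewrite eq_le pq//=; rewrite pN// lerN2 in pu0.
Qed.

End hahn_banach.

(** * States and the Choquet boundary *)

(** The family is a filter base, and a cluster point of its filter lies in every closed member. *)
Lemma compact_directed (T : topologicalType) (I : Type) (D : set I) (f : I -> set T) :
  compact [set: T] -> D !=set0 -> (forall i, D i -> closed (f i)) ->
  (forall i j, D i -> D j -> exists2 k, D k & f k `<=` f i `&` f j) ->
  (forall i, D i -> f i !=set0) -> exists x, forall i, D i -> f i x.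
Proof.
move=> cT [i0 Di0] fcl fdir fne.
have FF : ProperFilter (filter_from D f).
  apply: filter_from_proper => //; apply: filter_from_filter; first by exists i0.
  by move=> i j /(fdir i)/[apply].
have [|x [_ cx]] := cT (filter_from D f) FF; first by exists i0.
exists x => i Di; apply: fcl => // B /(cx (f i) B); apply.
by exists i.
Qed.

Lemma nbhs_normc_continuous (R : realType) (T : topologicalType) (F : T -> R[i]^o) x (e : R) :
  continuous F -> 0 < e -> nbhs x [set y | normc (F y - F x) < e].
Proof. by move=> cF e0; have /cvg_normcP := cF x; exact. Qed.

Section uniform_closure.
Variables (R : realType) (A : comAlgType R[i]).
Hypothesis gA : gelfand_algebra A.
Let M := maxspace A.
Implicit Types (f g : A) (x y : M).

Lemma gelfand_bounded f : exists2 c : R, 0 <= c & forall x, normc (gelfand f x) <= c.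
Proof.
have /compact_near_coveringP near_M := gA.1.
have := near_M R (pinfty_nbhs R) (fun c x => normc (gelfand f x) <= c) _.
case=> [x _|c [cr bound]].
  exists ([set y | normc (gelfand f y - gelfand f x) < 1],
          [set c | normc (gelfand f x) + 1 < c]).
    split; first exact: nbhs_gelfand.
    by exists (normc (gelfand f x) + 1); split => //; exact: num_real.
  move=> [y c] /= [yx xc].
  have := normcD (gelfand f y - gelfand f x) (gelfand f x); rewrite subrK.
  by move=> ?; lra.
exists (Num.max 0 (c + 1)) => [|x]; first by rewrite le_max lexx.
apply: (@le_trans _ _ (c + 1)); last by rewrite le_max lexx orbT.
by apply: (bound (c + 1)) => //; rewrite ltrDl.
Qed.

Lemma clP (F : {uniform M -> R[i]^o}) : cl A F <->
  continuous (F : M -> R[i]^o) /\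
  forall e : R, 0 < e -> exists f, forall x, normc (F x - gelfand f x) < e.
Proof.
split=> [[cF clF]|[cF approx]]; split => //.
  move=> e e0; have eC : 0 < e%:C%C by rewrite ltcR.
  have [|_ [[f _ <-] fF]] := clF [set h | forall x, ball (F x) e%:C%C (h x)].
    apply/uniform_nbhs; exists [set xy | ball xy.1 e%:C%C xy.2]; split.
      exact: (entourage_ball _ (PosNum eC)).
    by move=> h /= Fh x; apply: Fh.
  exists f => x; have := fF x.
  by rewrite -ball_normE /= normr_normc ltcR.
move=> B /uniform_nbhs[E [entE EB]].
have [e /= e0 eE] : exists2 e : R, 0 < e &
    [set xy : R[i]^o * R[i]^o | normc (xy.1 - xy.2) < e] `<=` E.
  have : entourage_ (@ball R[i] R[i]^o) E by rewrite entourage_ballE.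
  case=> e /= e0 eE; have eE' : e = (complex.Re e)%:C%C by rewrite RRe_real// gtr0_real.
  exists (complex.Re e); first by rewrite -ltcR -eE'.
  move=> [z w] /= zw; apply: eE => /=.
  by rewrite -ball_normE /= normr_normc eE' ltcR.
have [f fF] := approx _ e0; exists (gelfand f); split; first by exists f.
by apply: EB => y _; apply: eE; exact: fF.
Qed.

Lemma cl_gelfand f : cl A (gelfand f).
Proof.
apply/clP; split; first exact: gelfand_continuous.
by move=> e e0; exists f => x; rewrite subrr normc0.
Qed.

Lemma cl_bounded (h : set_type (cl A)) : exists2 c : R, 0 <= c & forall x, normc (set_val h x) <= c.
Proof.
have [_ /(_ _ ltr01)[f fh]] := (clP (set_val h)).1 (set_valP h).
have [c c0 fc] := gelfand_bounded f; exists (c + 1); first lra.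
move=> x; have := normcD (set_val h x - gelfand f x) (gelfand f x); rewrite subrK.
by have := fh x; have := fc x; lra.
Qed.

Lemma cl_axpy (a : R[i]) (h k : set_type (cl A)) :
  cl A (fun x => a * set_val h x + set_val k x).
Proof.
have /clP[ch happ] := set_valP h; have /clP[ck kapp] := set_valP k.
apply/clP; split.
  move=> x; apply/(@cvg_normcP _ _ (nbhs x) (nbhs_filter x)) => e e0.
  have d0 : 0 < e / (normc a + 1) by rewrite divr_gt0// ltr_wpDl// normc_ge0.
  have hx := nbhs_normc_continuous x ch d0.
  have kx := nbhs_normc_continuous x ck d0.
  have Fx : Filter (nbhs x) by exact: nbhs_filter.
  apply: (@filterS _ _ Fx _ _ _ (@filterI _ _ Fx _ _ hx kx)) => y /= [hy ky].
  have -> : a * set_val h y + set_val k y - (a * set_val h x + set_val k x) =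
    a * (set_val h y - set_val h x) + (set_val k y - set_val k x) by ring.
  apply: le_lt_trans (normcD _ _) _; rewrite normcM.
  have dE : e / (normc a + 1) * (normc a + 1) = e by rewrite divfK// gt_eqF// ltr_wpDl// normc_ge0.
  have := normc_ge0 a; nra.
move=> e e0; have d0 : 0 < e / (normc a + 1) by rewrite divr_gt0// ltr_wpDl// normc_ge0.
have [f fh] := happ _ d0; have [g gk] := kapp _ d0.
exists (a *: f + g) => x; rewrite gelfandD gelfandZ.
have -> : a * set_val h x + set_val k x - (a * gelfand f x + gelfand g x) =
  a * (set_val h x - gelfand f x) + (set_val k x - gelfand g x) by ring.
apply: le_lt_trans (normcD _ _) _; rewrite normcM.
have dE : e / (normc a + 1) * (normc a + 1) = e by rewrite divfK// gt_eqF// ltr_wpDl// normc_ge0.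
by have := normc_ge0 a; have := fh x; have := gk x; nra.
Qed.

Definition clg f : set_type (cl A) := SigSub (mem_set (cl_gelfand f)).
(** [cl A] is a bare set of functions; this is the one operation by which [state_space] expresses
    linearity. *)
Definition axpy a h k : set_type (cl A) := SigSub (mem_set (cl_axpy a h k)).

Lemma clgE f x : set_val (clg f) x = gelfand f x. Proof. by []. Qed.

Lemma axpyE a h k x : set_val (axpy a h k) x = a * set_val h x + set_val k x.
Proof. by []. Qed.

Lemma cl_ext (h k : set_type (cl A)) : (forall x, set_val h x = set_val k x) -> h = k.
Proof. by move=> hk; apply: val_inj; apply: funext. Qed.

Lemma supnorm_le (F : M -> R[i]) c : 0 <= c -> (forall x, normc (F x) <= c) -> supnorm F <= c.
Proof.
move=> c0 Fc; rewrite /supnorm.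
have [ne|/nonemptyPn ->] := pselect (range (fun x => normc (F x)) !=set0).
  by apply: ge_sup => // _ [x _ <-].
(* Without characters the supremum is that of the empty set, which is 0. *)
by rewrite sup0.
Qed.

Lemma le_supnorm (F : M -> R[i]) c x : (forall y, normc (F y) <= c) -> normc (F x) <= supnorm F.
Proof.
move=> Fc; apply: ub_le_sup; last by exists x.
by exists c => _ [y _ <-].
Qed.

Section states.
Variable L : set_type (cl A) -> R[i]^o.
Hypothesis sL : state_space L.

Lemma state_axpy a h k : L (axpy a h k) = a * L h + L k.
Proof. by case: sL => lin _ _; apply: lin. Qed.

Lemma state_comb a b f g : L (clg (a *: f + b *: g)) = a * L (clg f) + b * L (clg g).
Proof.
case: sL => lin _ _.
have L0 : L (clg 0) = 0.
  have : L (clg 0) = 1 * L (clg 0) + L (clg 0).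
    by apply: lin => x; rewrite !clgE gelfand0 mulr0 addr0.
  by rewrite mul1r -{1}[L _]addr0 => /addrI.
rewrite (lin a (clg f) (clg (b *: g)) (clg (a *: f + b *: g))) => [|x]; last first.
  by rewrite !clgE gelfandD !gelfandZ.
rewrite (lin b (clg g) (clg 0) (clg (b *: g))) ?L0 ?addr0// => x.
by rewrite !clgE gelfandZ gelfand0 addr0.
Qed.

Lemma state1 : L (clg 1) = 1.
Proof. by case: sL => _ -> // x; rewrite clgE gelfand1. Qed.

Lemma state_const z : L (clg z%:A) = z.
Proof.
have := state_comb z 0 1 0; rewrite state1 scale0r addr0 => ->.
by rewrite mul0r addr0 mulr1.
Qed.

Lemma state_norm h c : 0 <= c -> (forall x, normc (set_val h x) <= c) -> normc (L h) <= c.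
Proof. by move=> c0 hc; case: sL => _ _ /(_ h)/le_trans; apply; exact: supnorm_le. Qed.

(* For large [r], [|r - h| <= r + c^2 / (2 r)] as soon as [0 <= Re h] and
   [|h| <= c], while [L] maps [r] to [r]. *)
Lemma state_ge0 h : (forall x, 0 <= complex.Re (set_val h x)) -> 0 <= complex.Re (L h).
Proof.
move=> h0; rewrite leNgt; apply/negP => Lh; set d := - complex.Re (L h).
have d0 : 0 < d by rewrite oppr_gt0.
have [c c0 hc] := cl_bounded h.
pose r := c ^+ 2 / d + 1; have r0 : 0 < r by rewrite ltr_wpDl// divr_ge0 ?sqr_ge0// ltW.
pose b := r + c ^+ 2 / (2 * r).
have b0 : 0 <= b by rewrite addr_ge0 ?(ltW r0)// divr_ge0 ?sqr_ge0// mulr_ge0// ltW.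
have cd : c ^+ 2 / (2 * r) < d.
  rewrite ltr_pdivrMr ?mulr_gt0//.
  have : d * r = c ^+ 2 + d by rewrite mulrDr mulr1 mulrC divfK// gt_eqF.
  have := sqr_ge0 c; nra.
have := @state_norm (axpy (-1) h (clg r%:C%C%:A)) b b0 _.
rewrite state_axpy state_const => /(_ _)/Wrap[x|].
  rewrite axpyE clgE gelfandA mulN1r addrC.
  apply: (normc_real_sub (ltW r0) (h0 x) (hc x) b0).
  have -> : b ^+ 2 = r ^+ 2 + c ^+ 2 + (c ^+ 2 / (2 * r)) ^+ 2 by rewrite /b; field; rewrite gt_eqF.
  by rewrite lerDl sqr_ge0.
move=> /(le_trans (ReleNormc _)); rewrite ReD mulN1r ReN -/d [complex.Re _%:C%C]/= /b; lra.
Qed.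

Lemma state_le h k : (forall x, complex.Re (set_val h x) <= complex.Re (set_val k x)) ->
  complex.Re (L h) <= complex.Re (L k).
Proof.
move=> hk; have := @state_ge0 (axpy (-1) h k) _.
rewrite state_axpy mulN1r ReD ReN => /(_ _)/Wrap[x|]; last lra.
by rewrite axpyE mulN1r ReD ReN; have := hk x; lra.
Qed.

Lemma state_le_const f c : (forall x, complex.Re (gelfand f x) <= c) ->
  complex.Re (L (clg f)) <= c.
Proof.
move=> fc; have := @state_le (clg f) (clg c%:C%C%:A); rewrite state_const; apply => x.
by rewrite !clgE gelfandA.
Qed.

End states.

Lemma state_evaluation x : state_space (evaluation x : set_type (cl A) -> R[i]^o).
Proof.
split=> [a f g h|h|h]; rewrite /evaluation; [exact|exact|].
by have [c _ hc] := cl_bounded h; exact: le_supnorm hc.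
Qed.

(** With [L h] rotated onto the positive axis by [w], positivity applied to [s - w h], where [s] is
    the supremum norm of [h], bounds [|L h|] by [s]. *)
Lemma state_of_monotone (L : set_type (cl A) -> R[i]^o) :
  (forall a h k, L (axpy a h k) = a * L h + L k) -> L (clg 1) = 1 ->
  (forall h, (forall x, 0 <= complex.Re (set_val h x)) -> 0 <= complex.Re (L h)) ->
  state_space L.
Proof.
move=> Lax L1 Lpos; split.
- move=> a f g h hE; have -> : h = axpy a f g by exact: cl_ext.
  exact: Lax.
- move=> h hE; have -> // : h = clg 1 by apply: cl_ext => x; rewrite hE clgE gelfand1.
move=> h; have [w w1 wL] := rotation_to_normc (L h).
have [c c0 hc] := cl_bounded h.
have L0 : L (clg 0) = 0.
  have := Lax 1 (clg 0) (clg 0); rewrite (_ : axpy _ _ _ = clg 0).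
    by rewrite mul1r -{1}[L _]addr0 => /addrI.
  by apply: cl_ext => x; rewrite axpyE !clgE gelfand0 mulr0 addr0.
set s := supnorm _.
have := Lpos (axpy s%:C%C (clg 1) (axpy (- w) h (clg 0))) _.
rewrite !Lax L1 L0 addr0 mulr1 mulNr wL ReD ReN [complex.Re _%:C%C]/= => /(_ _)/Wrap[x|].
  rewrite !axpyE !clgE gelfand1 gelfand0 mulr1 addr0 mulNr ReD ReN [complex.Re _%:C%C]/= subr_ge0.
  apply: le_trans (ReleNormc _) _; rewrite normcM w1 mul1r; exact: le_supnorm hc.
by rewrite subr_ge0.
Qed.

End uniform_closure.

(** * Maxima on the Choquet boundary and a criterion for membership *)

Section choquet_boundary.
Variables (R : realType) (A : comAlgType R[i]).
Hypothesis gA : gelfand_algebra A.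
Let M := maxspace A.
Implicit Types (f g : A) (x y : M).
Local Notation E := (set_type (cl A)).
Local Notation "'rep' x L1 L2 t" :=
  (evaluation x = t%:C%C *: L1 + (1 - t)%:C%C *: L2 :> (E -> R[i]^o))
  (at level 10, x, L1, L2, t at level 9).

Let closed_Re_ge f c : closed [set x : M | c <= complex.Re (gelfand f x)].
Proof.
move=> x clx; rewrite /= leNgt; apply/negP => fx.
have e0 : 0 < c - complex.Re (gelfand f x) by rewrite subr_gt0.
have [y [/= cy yx]] := clx _ (nbhs_gelfand f x e0).
by have := ReleNormc (gelfand f y - gelfand f x); rewrite ReB; lra.
Qed.

(* The sets of characters in a face of the state space have this property. *)
Definition absorbing (F : set M) : Prop :=
  [/\ F !=set0, closed F & forall x (L1 L2 : E -> R[i]^o) (t : R),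
    F x -> state_space L1 -> state_space L2 -> 0 < t < 1 -> rep x L1 L2 t ->
    forall f c, (forall y, F y -> complex.Re (gelfand f y) <= c) ->
      complex.Re (L1 (clg f)) <= c].

Let rep_swap x (L1 L2 : E -> R[i]^o) t : 0 < t < 1 -> rep x L1 L2 t ->
  0 < 1 - t < 1 /\ rep x L2 L1 (1 - t).
Proof. by move=> t01 ->; split; [lra|rewrite subKr addrC]. Qed.

Let rep_at x (L1 L2 : E -> R[i]^o) t h : rep x L1 L2 t ->
  set_val h x = t%:C%C * L1 h + (1 - t)%:C%C * L2 h.
Proof. by move=> /(congr1 (fun F => F h)). Qed.

Let Re_rep x (L1 L2 : E -> R[i]^o) t f : rep x L1 L2 t ->
  complex.Re (gelfand f x) = t * complex.Re (L1 (clg f)) + (1 - t) * complex.Re (L2 (clg f)).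
Proof. by move=> /(rep_at (clg f)); rewrite clgE => ->; rewrite ReD !ReZ. Qed.

(** Both states that represent a point where [Re f] has its maximum [m] on [F] must give [Re f] the
    value [m]. So real multiples of [f - m] can be added to [k] without changing [Re (L1 k)]. *)
Lemma absorbing_argmax F f : absorbing F ->
  absorbing (F `&` [set x | forall y, F y -> complex.Re (gelfand f y) <= complex.Re (gelfand f x)]).
Proof.
move=> [F0 clF aF]; set G := _ `&` _.
have cont_closed (h : A) c : closed (F `&` [set z | c <= complex.Re (gelfand h z)]).
  by apply: closedI => //; exact: closed_Re_ge.
have [x Fx] : G !=set0.
  have [y Fy|y z Fy Fz|y Fy|x xP] := @compact_directed M M F
      (fun y => F `&` [set z | complex.Re (gelfand f y) <= complex.Re (gelfand f z)]) gA.1 F0.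
  - exact: cont_closed.
  - have [yz|/ltW zy] := leP (complex.Re (gelfand f y)) (complex.Re (gelfand f z)).
      by exists z => // w [Fw /= zw]; split; split => //=; exact: le_trans zw.
    by exists y => // w [Fw /= yw]; split; split => //=; exact: le_trans yw.
  - by exists y; split => /=.
  - have [w Fw] := F0; exists x; split; first by case: (xP w Fw).
    by move=> y /xP[].
have clG : closed G.
  rewrite (_ : G = F `&` [set z | complex.Re (gelfand f x) <= complex.Re (gelfand f z)]) //.
  apply/seteqP; split=> y [Fy fy]; split => //=; first by apply: fy; case: Fx.
  by move=> z Fz; apply: le_trans fy; apply: Fx.2.
split => //; first by exists x.
move: x Fx clG => x0 Gx0 clG x L1 L2 t [Fx xmax] s1 s2 t01 xL k c kc.
set m := complex.Re (gelfand f x).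
have Lm : complex.Re (L1 (clg f)) = m.
  have le1 : complex.Re (L1 (clg f)) <= m by apply: (aF x L1 L2 t).
  have [t01' xL'] := rep_swap t01 xL.
  have le2 : complex.Re (L2 (clg f)) <= m by apply: (aF x L2 L1 (1 - t)).
  have := Re_rep f xL; rewrite -/m; nra.
apply/ler_addgt0Pl => e e0.
(* [Re k <= c] is known only where [Re f] is maximal; a large multiple of [f - m] pushes the rest of
   [F] down. Otherwise compactness gives a point of [F] that resists every [n]: there [Re f = m],
   and yet [Re k] exceeds [c]. *)
have [n nP] : exists n : nat, forall y, F y ->
    complex.Re (gelfand (k + n%:R%:C%C *: (f - m%:C%C%:A)) y) <= e + c.
  apply: contrapT => no.
  have step y (i : nat) : complex.Re (gelfand (k + i%:R%:C%C *: (f - m%:C%C%:A)) y) =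
      complex.Re (gelfand k y) + i%:R * (complex.Re (gelfand f y) - m).
    by rewrite gelfandD gelfandZ gelfandB gelfandA ReD ReZ ReB.
  have le_m y : F y -> complex.Re (gelfand f y) - m <= 0 by move=> /xmax; rewrite -/m; lra.
  have [|i _|i j _ _|i _|y yP] := @compact_directed M nat setT
    (fun i => F `&` [set z | e + c <=
      complex.Re (gelfand (k + i%:R%:C%C *: (f - m%:C%C%:A)) z)]) gA.1.
  - by exists 0%N.
  - exact: cont_closed.
  - exists (maxn i j) => // y [Fy /=]; rewrite step => yk.
    have leij : i%:R <= (maxn i j)%:R :> R /\ j%:R <= (maxn i j)%:R :> R.
      by rewrite !ler_nat leq_maxl leq_maxr.
    have := le_m y Fy.
    by split; split => //=; rewrite step; nra.
  - apply: contrapT => noi; apply: no; exists i => y Fy; rewrite leNgt; apply/negP => ky.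
    by apply: noi; exists y; split => //=; exact: ltW.
  have [Fy _] := yP 0%N Logic.I.
  have ym : complex.Re (gelfand f y) = m.
    apply/eqP; rewrite eq_le; apply/andP; split; first by have := le_m y Fy; lra.
    rewrite leNgt; apply/negP => ym.
    pose d := m - complex.Re (gelfand f y); have d0 : 0 < d by rewrite subr_gt0.
    have [i iP] : exists i : nat, (`|complex.Re (gelfand k y) - (e + c)| + 1) / d <= i%:R.
      have : 0 <= (`|complex.Re (gelfand k y) - (e + c)| + 1) / d.
        by apply: divr_ge0; [rewrite addr_ge0|exact: ltW].
      by move=> /archi_boundP/ltW; eexists; eassumption.
    have [_ /=] := yP i Logic.I; rewrite step.
    rewrite ler_pdivrMr// in iP; have := ler_norm (complex.Re (gelfand k y) - (e + c)).
    have : i%:R * (complex.Re (gelfand f y) - m) = - (i%:R * d) by rewrite /d; ring.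
    lra.
  have [_ /=] := yP 0%N Logic.I; rewrite step mul0r addr0.
  have := kc y; rewrite /G /= => /(_ _)/Wrap[|]; last lra.
  by split => // z Fz; rewrite ym; exact: xmax.
have := aF x L1 L2 t Fx s1 s2 t01 xL _ _ nP.
have := state_comb s1 1 n%:R%:C%C k (f - m%:C%C%:A); rewrite scale1r mul1r => ->.
have := state_comb s1 1 (-1) f m%:C%C%:A; rewrite scale1r mul1r scaleN1r mulN1r state_const// => ->.
by rewrite ReD ReZ ReB Lm subrr mulr0 addr0.
Qed.

Lemma state_eq_evaluation (L : E -> R[i]^o) x : state_space L ->
  (forall f, L (clg f) = gelfand f x) -> L = evaluation x.
Proof.
move=> s1 LE; apply: funext => h; apply: eq_of_small_dist => e e0.
have e2 : 0 < e / 2 by lra.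
have [_ /(_ _ e2)[f fh]] := (clP (set_val h)).1 (set_valP h).
rewrite /evaluation.
have -> : L h - set_val h x = (L h - gelfand f x) + (gelfand f x - set_val h x) by ring.
have := normcD (L h - gelfand f x) (gelfand f x - set_val h x).
have := fh x; rewrite normc_distC.
suff : normc (L h - gelfand f x) <= e / 2 by lra.
rewrite -LE; have := state_axpy s1 (-1) (clg f) h; rewrite mulN1r addrC => <-.
apply: (state_norm s1); first lra.
by move=> y; rewrite axpyE clgE mulN1r addrC ltW.
Qed.

(** The bounds for [f] and [- f] fix the real part of [L1 f], those for [i f] the imaginary part;
    the transforms are dense in [cl A]. *)
Lemma choquet_of_absorbing1 x : absorbing [set x] -> Ch (cl A) x.
Proof.
move=> [_ _ aF]; split; first exact: (state_evaluation gA).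
have key (L1 L2 : E -> R[i]^o) t : state_space L1 -> state_space L2 -> 0 < t < 1 ->
    rep x L1 L2 t -> L1 = evaluation x.
  move=> s1 s2 t01 xL.
  have Le f : complex.Re (L1 (clg f)) <= complex.Re (gelfand f x).
    by apply: (aF x L1 L2 t) => // y ->.
  have ReE f : complex.Re (L1 (clg f)) = complex.Re (gelfand f x).
    apply/eqP; rewrite eq_le Le/=; have := Le (- f).
    have := state_comb s1 (-1) 0 f 0; rewrite scaleN1r scale0r addr0 mul0r addr0 mulN1r => ->.
    by rewrite gelfandN !ReN lerN2.
  apply: (state_eq_evaluation s1) => f; apply/eqP; rewrite eq_complex ReE eqxx/=.
  have := ReE ('i%C *: f).
  have := state_comb s1 'i%C 0 f 0; rewrite scale0r addr0 mul0r addr0 => ->.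
  rewrite gelfandZ; case: (L1 _) (gelfand f x) => a b [c d] /=; rewrite !mul0r !mul1r !sub0r.
  by move=> /oppr_inj ->.
move=> L1 L2 t s1 s2 t01 xL; split; first exact: key xL.
by have [t01' xL'] := rep_swap t01 xL; exact: key xL'.
Qed.

(** A Krein-Milman argument on closed sets of characters: [absorbing_argmax] makes every real part
    constant on a minimal absorbing subset of the set where [f] takes the value [f(x0)], so this
    subset is a single character. *)
Theorem choquet_boundary f x0 : (forall x, normc (gelfand f x) <= normc (gelfand f x0)) ->
  exists2 y, Ch (cl A) y & gelfand f y = gelfand f x0.
Proof.
move=> fmax; have [w w1 wf] := rotation_to_normc (gelfand f x0).
have aT : absorbing [set: M].
  split; [by exists x0|exact: closedT|].
  move=> x L1 L2 t _ s1 _ _ _ g c gc; apply: (state_le_const gA s1) => y; exact: gc.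
have := absorbing_argmax (w *: f) aT; set F0 := _ `&` _ => aF0.
(* [Re (w f(x)) >= |f(x0)| >= |w f(x)|] leaves only [w f(x) = |f(x0)|]. *)
have F0E x : F0 x -> gelfand f x = gelfand f x0.
  move=> [_ /(_ x0 Logic.I)]; rewrite !gelfandZ wf => le.
  have w0 : w != 0 by rewrite -normc_gt0 w1.
  apply: (mulfI w0); rewrite wf.
  have nwx : normc (w * gelfand f x) <= normc (gelfand f x0) by rewrite normcM w1 mul1r.
  move: (w * gelfand f x) (normc (gelfand f x0)) (normc_ge0 (gelfand f x0)) nwx le => z r r0 zr rz.
  have : normc z ^+ 2 <= r ^+ 2 by rewrite ler_sqr ?nnegrE ?normc_ge0.
  rewrite sqr_normcE; case: z zr rz => a b /= _ ra ab; have b0 : b = 0 by nra.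
  by apply/eqP; rewrite eq_complex/= b0 eqxx andbT; apply/eqP; nra.
(* A maximal set [U] to be removed leaves a minimal absorbing set; the empty chain removes nothing
   and leaves [F0]. *)
have [G Gchain|U [aU Umax]] := @Zorn_bigcup M (fun U => absorbing (F0 `\` U)).
  move=> Gtot.
  have [[X0 GX0]|G0] := pselect (G !=set0); last first.
    rewrite (_ : G = set0) ?bigcup_set0 ?setD0//.
    by apply/seteqP; split=> // X GX; apply: G0; exists X.
  have interE x : (forall X, G X -> (F0 `\` X) x) -> (F0 `\` \bigcup_(X in G) X) x.
    move=> xG; split; first by case: (xG _ GX0).
    by move=> [X GX Xx]; case: (xG _ GX).
  have sub X x : G X -> (F0 `\` \bigcup_(X in G) X) x -> (F0 `\` X) x.
    by move=> GX [Fx nx]; split => // Xx; apply: nx; exists X.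
  have dir X Y : G X -> G Y -> exists2 Z, G Z & X `<=` Z /\ Y `<=` Z.
    by move=> GX GY; have [XY|YX] := Gtot _ _ GX GY; [exists Y => //; split|exists X => //; split].
  have clX X : G X -> closed (F0 `\` X) by move=> /Gchain[].
  split.
  - have [|X GX|X Y GX GY|X /Gchain[]//|x xP] :=
      @compact_directed M (set M) G (fun X => F0 `\` X) gA.1.
    + by exists X0.
    + exact: clX GX.
    + have [Z GZ [XZ YZ]] := dir _ _ GX GY; exists Z => // x [Fx nZ].
      by split; split => // ?; apply: nZ; [exact: XZ|exact: YZ].
    + by exists x; exact: interE.
  - rewrite (_ : F0 `\` _ = \bigcap_(X in G) (F0 `\` X)); first exact: closed_bigI.
    by apply/seteqP; split=> x xP; [move=> X GX; exact: sub xP|exact: interE].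
  - move=> x L1 L2 t Fx s1 s2 t01 xL g c gc; apply/ler_addgt0Pl => e e0.
    have [X GX XP] : exists2 X, G X & forall y, (F0 `\` X) y -> complex.Re (gelfand g y) <= e + c.
      apply: contrapT => no.
      have [|X GX|X Y GX GY|X GX|y yP] := @compact_directed M (set M) G
         (fun X => (F0 `\` X) `&` [set y | e + c <= complex.Re (gelfand g y)]) gA.1.
      + by exists X0.
      + by apply: closedI; [exact: clX GX|exact: closed_Re_ge].
      + have [Z GZ [XZ YZ]] := dir _ _ GX GY; exists Z => // y [[Fy nZ] gy].
        by split; split => //; split => // ?; apply: nZ; [exact: XZ|exact: YZ].
      + apply: contrapT => noX; apply: no; exists X => // y Fy; rewrite leNgt; apply/negP => gy.
        by apply: noX; exists y; split => //=; exact: ltW.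
      have [_ /=] := yP _ GX0; have := gc y => /(_ _)/Wrap[|]; last lra.
      by apply: interE => X /yP[].
    have [_ _ aX] := Gchain _ GX.
    by apply: (aX x L1 L2 t) => //; exact: sub Fx.
set F := F0 `\` U in aU.
have [[y Fy] _ _] := aU.
have Fmin f' x : F x -> complex.Re (gelfand f' x) = complex.Re (gelfand f' y).
  have aG := absorbing_argmax f' aU; set G := _ `&` _ in aG.
  have GF : G = F.
    apply/seteqP; split; first by move=> z [].
    move=> z Fz; apply: contrapT => nGz; apply: (Umax (~` G)).
      split=> [u Uu [[_ nU] _]//|/(_ z nGz) Uz]; by case: Fz.
    rewrite (_ : F0 `\` ~` G = G)//; apply/seteqP; split=> [u [_ /contrapT]//|u Gu].
    by split; [case: Gu => -[]|move=> /(_ Gu)].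
  move=> Fx; apply/eqP; rewrite eq_le.
  have [_ xm] : G x by rewrite GF.
  have [_ ym] : G y by rewrite GF.
  by rewrite xm// ym.
have F1 : F = [set y].
  apply/seteqP; split=> [x Fx|x ->//]; apply: gelfand_inj => g.
  apply/eqP; rewrite eq_complex Fmin// eqxx/=.
  have := Fmin ('i%C *: g) x Fx; rewrite !gelfandZ.
  case: (gelfand g x) (gelfand g y) => a b [c d] /=.
  by rewrite !mul0r !mul1r !sub0r => /oppr_inj ->.
exists y; first by apply: choquet_of_absorbing1; rewrite -F1.
by apply: F0E; case: Fy.
Qed.


(** For [k] vanishing at [x], split [k = h k + (1 - h) k], with [h] rotated to be positive at [x].
    The first term is small. For the second, [|1 - h|^2 <= 2 (1 - Re h)], and [Re (L1 h)] is close
    to 1 because its average with [Re (L2 h) <= 1] is [h(x)]. *)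
Theorem choquet_of_peaking x :
  (forall k, gelfand k x = 0 -> forall d : R, 0 < d -> exists h,
     [/\ forall y, normc (gelfand h y) <= 1, 1 - d <= normc (gelfand h x) &
         forall y, normc (gelfand h y * gelfand k y) <= d]) ->
  Ch (cl A) x.
Proof.
move=> peak; split; first exact: (state_evaluation gA).
have key (L1 L2 : E -> R[i]^o) t : state_space L1 -> state_space L2 -> 0 < t < 1 ->
    rep x L1 L2 t -> L1 = evaluation x.
  move=> s1 s2 t01 xL; apply: (state_eq_evaluation s1) => f.
  pose k := f - (gelfand f x)%:A.
  have kx : gelfand k x = 0 by rewrite gelfandB gelfandA subrr.
  have -> : L1 (clg f) = L1 (clg k) + gelfand f x.
    have := state_comb s1 1 (-1) f (gelfand f x)%:A.
    rewrite scale1r scaleN1r -/k mul1r mulN1r state_const// => ->.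
    by rewrite subrK.
  clearbody k; apply: eq_of_small_dist => e e0; rewrite addrK.
  have [c c0 kc] := gelfand_bounded gA k.
  have c1 : 0 < c + 1 by rewrite ltr_wpDl.
  (* [a] is the weight in [|1 - h| <= a / 2 + (1 - Re h) / a]. The errors [d], [c a / 2] and
     [(c / a) (d / t)] become at most [e/4], [e/2] and [e/4]. *)
  pose a := e / (c + 1); have a0 : 0 < a by rewrite divr_gt0// ltr_wpDl.
  have ac : a * (c + 1) = e by rewrite divfK// gt_eqF// ltr_wpDl.
  pose d := Num.min (e / 4) (e * a * t / (4 * (c + 1))).
  have t0 : 0 < t by lra.
  have d0 : 0 < d.
    by rewrite lt_min; apply/andP; split; apply: divr_gt0 => //; do !apply: mulr_gt0 => //.
  have d_e : d <= e / 4 by rewrite ge_min lexx.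
  have d_a : d * (4 * (c + 1)) <= e * a * t.
    have c4 : 0 < 4 * (c + 1) by rewrite mulr_gt0.
    by rewrite -ler_pdivlMr// ge_min lexx orbT.
  have [h0 [h0_le1 h0x h0k]] := peak k kx d d0.
  have [w w1 wh] := rotation_to_normc (gelfand h0 x).
  pose h := w *: h0.
  have h_le1 y : normc (gelfand h y) <= 1 by rewrite gelfandZ normcM w1 mul1r.
  have hk y : normc (gelfand (h * k) y) <= d.
    by rewrite gelfandM gelfandZ -mulrA normcM w1 mul1r.
  have hx : gelfand h x = (normc (gelfand h0 x))%:C%C by rewrite gelfandZ.
  clearbody h.
  have L1h : 1 - complex.Re (L1 (clg h)) <= d / t.
    have := Re_rep h xL; rewrite hx [complex.Re _%:C%C]/=.
    have : complex.Re (L2 (clg h)) <= 1.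
      by apply: (state_le_const gA s2) => y; apply: le_trans (h_le1 y); exact: ReleNormc.
    rewrite ler_pdivlMr//; nra.
  have Lhk : normc (L1 (clg (h * k))) <= d by apply: (state_norm s1) => //; exact: ltW.
  have L1k : normc (L1 (clg ((1 - h) * k))) <= c * a / 2 + c / a * (d / t).
    have [v v1 vL] := rotation_to_normc (L1 (clg ((1 - h) * k))).
    pose b := c / a; have b0 : 0 <= b by rewrite divr_ge0// ltW.
    have ba : b * a = c by rewrite divfK// gt_eqF.
    have := @state_le _ _ gA _ s1 (clg (v *: ((1 - h) * k)))
      (clg ((c * a / 2 + b)%:C%C%:A - b%:C%C *: h)).
    have := state_comb s1 v 0 ((1 - h) * k) 0; rewrite scale0r addr0 mul0r addr0 vL => ->.
    have := state_comb s1 1 (- b%:C%C) (c * a / 2 + b)%:C%C%:A h.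
    rewrite scale1r scaleNr mul1r mulNr state_const// => ->.
    rewrite ReB ReZ ![complex.Re _%:C%C]/= => /(_ _)/Wrap[y|le].
      rewrite !clgE gelfandZ gelfandM !gelfandB gelfand1 gelfandA gelfandZ.
      rewrite ReB ReZ [complex.Re _%:C%C]/=.
      apply: le_trans (ReleNormc _) _; rewrite !normcM v1 mul1r.
      have := kc y; have := normc_ge0 (gelfand k y); have := h_le1 y.
      rewrite -[1 in X in X -> _](expr1n _ 2).
      have : normc (1 - gelfand h y) ^+ 2 =
          1 - 2 * complex.Re (gelfand h y) + normc (gelfand h y) ^+ 2.
        by rewrite !sqr_normcE; case: (gelfand h y) => p q /=; ring.
      have := normc_ge0 (1 - gelfand h y); have := normc_ge0 (gelfand h y).
      move: (normc (1 - _)) (normc (gelfand h y)) (normc (gelfand k y)) (complex.Re _) => s n l r.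
      move=> n0 s0 sE n1 l0 lc.
      have s_sqr : s ^+ 2 <= 2 * (1 - r) by move: n1; rewrite expr1n; nra.
      have amgm : a * s <= a ^+ 2 / 2 + (1 - r) by have := sqr_ge0 (s - a); nra.
      apply: (@le_trans _ _ (s * c)); first by rewrite ler_wpM2l.
      have -> : c * a / 2 + b - b * r = b * (a ^+ 2 / 2 + (1 - r)) by rewrite -ba; ring.
      by rewrite -ba mulrC -mulrA ler_wpM2l// mulrC.
    apply: le_trans le _; rewrite -/b.
    have : b * (1 - complex.Re (L1 (clg h))) <= b * (d / t) by rewrite ler_wpM2l.
    lra.
  have -> : L1 (clg k) = L1 (clg (h * k)) + L1 (clg ((1 - h) * k)).
    have := state_comb s1 1 1 (h * k) ((1 - h) * k); rewrite !scale1r !mul1r => <-.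
    by congr (L1 (clg _)); ring.
  apply: le_trans (normcD _ _) _.
  have : c / a * (d / t) <= e / 4.
    rewrite (_ : c / a * (d / t) = c * d / (a * t)); last by field; rewrite !gt_eqF.
    clear -c0 d0 d_a a0 t0; clearbody a d.
    have at0 : 0 < a * t by rewrite mulr_gt0.
    by rewrite ler_pdivrMr//; nra.
  have : c * a / 2 <= e / 2 by clear -c0 a0 ac; clearbody a; lra.
  lra.
move=> L1 L2 t s1 s2 t01 xL; split; first exact: key xL.
by have [t01' xL'] := rep_swap t01 xL; exact: key xL'.
Qed.

End choquet_boundary.

(** * Peaking elements at points of the Choquet boundary *)

Section peaking.
Variables (R : realType) (A : comAlgType R[i]).
Hypothesis gA : gelfand_algebra A.
Let M := maxspace A.
Implicit Types (f g : A) (y : M).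
Local Notation E := (set_type (cl A)).
Variable x : M.
Hypothesis Chx : Ch (cl A) x.

Let bounded : set (M -> R^o) := [set u | exists c : R, forall y, `|u y| <= c].

Let boundedD u v : bounded u -> bounded v -> bounded (u + v).
Proof.
move=> [c uc] [d vd]; exists (c + d) => y.
by apply: le_trans (ler_normD _ _) _; exact: lerD.
Qed.

Let boundedZ (t : R) u : bounded u -> bounded (t *: u).
Proof.
move=> [c uc]; exists (`|t| * c) => y.
by rewrite /= normrM ler_wpM2l.
Qed.

Let majorants (u : M -> R^o) :=
  [set complex.Re (gelfand g x) | g in [set g | forall y, u y <= complex.Re (gelfand g y)]].

(** The upper envelope of [u] at [x]. A linear functional below it is positive and sends [Re g] to
    [Re g(x)], like integration against a representing measure. *)
Let envelope (u : M -> R^o) : R := inf (majorants u).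

Let majorants_has u : bounded u -> has_inf (majorants u).
Proof.
move=> [c uc]; split.
  exists c; exists c%:C%C%:A; last by rewrite gelfandA.
  by move=> y; rewrite gelfandA /=; apply: le_trans (uc y); exact: ler_norm.
by exists (u x) => _ [g /= ug <-]; exact: ug.
Qed.

Let envelope_le u g : bounded u -> (forall y, u y <= complex.Re (gelfand g y)) ->
  envelope u <= complex.Re (gelfand g x).
Proof. by move=> bu ug; apply: ge_inf; [case: (majorants_has bu)|exists g]. Qed.

Let envelope_ge u c : bounded u ->
  (forall g, (forall y, u y <= complex.Re (gelfand g y)) -> c <= complex.Re (gelfand g x)) ->
  c <= envelope u.
Proof.
move=> bu cu; apply: lb_le_inf; first by case: (majorants_has bu).
by move=> _ [g ug <-]; exact: cu.
Qed.

Let envelope_sublinear : sublinear bounded envelope.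
Proof.
split=> [u v bu bv|t u t0 bu].
  rewrite -lerBlDr; apply: envelope_ge => // g ug.
  rewrite lerBlDr -lerBlDl; apply: envelope_ge => // h vh.
  rewrite lerBlDl -ReD -gelfandD; apply: envelope_le; first exact: boundedD.
  by move=> y; rewrite gelfandD ReD; exact: lerD.
have le s w : 0 < s -> bounded w -> s * envelope w <= envelope (s *: w).
  move=> s0 bw; apply: envelope_ge => [|g wg]; first exact: boundedZ.
  rewrite mulrC -ler_pdivlMr// mulrC -ReZ -gelfandZ; apply: envelope_le => // y.
  by rewrite gelfandZ ReZ ler_pdivlMl//; exact: wg.
apply/eqP; rewrite eq_le le// andbT.
have := le t^-1 (t *: u); rewrite invr_gt0 => /(_ t0 (boundedZ t bu)).
by rewrite scalerA mulVf ?gt_eqF// scale1r mulrC ler_pdivrMr// mulrC.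
Qed.

Section representing_functional.
Variable L : (M -> R^o) -> R.
Hypothesis LD : forall u v, bounded u -> bounded v -> L (u + v) = L u + L v.
Hypothesis LZ : forall (t : R) u, bounded u -> L (t *: u) = t * L u.
Hypothesis L_le : forall u, bounded u -> L u <= envelope u.

Let LN u : bounded u -> L (- u) = - L u.
Proof. by move=> bu; rewrite -scaleN1r LZ// mulN1r. Qed.

Let boundedN u : bounded u -> bounded (- u).
Proof. by rewrite -scaleN1r; exact: boundedZ. Qed.

Let L_le_Re u g : bounded u -> (forall y, u y <= complex.Re (gelfand g y)) ->
  L u <= complex.Re (gelfand g x).
Proof. by move=> bu ug; apply: le_trans (L_le bu) _; exact: envelope_le. Qed.

Let L_le_const u c : bounded u -> (forall y, u y <= c) -> L u <= c.
Proof.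
move=> bu uc; have := @L_le_Re u c%:C%C%:A bu; rewrite gelfandA; apply=> y.
by rewrite gelfandA; exact: uc.
Qed.

Let L_mono u v : bounded u -> bounded v -> (forall y, u y <= v y) -> L u <= L v.
Proof.
move=> bu bv uv; rewrite -subr_le0 -LN// -LD//; last exact: boundedN.
apply: L_le_const => [|y]; first by apply: boundedD => //; exact: boundedN.
by rewrite subr_le0; exact: uv.
Qed.

Let L_const c : L (fun=> c) = c.
Proof.
have bc (d : R) : bounded (fun=> d) by exists `|d|.
apply/eqP; rewrite eq_le L_le_const//= -lerN2 -LN//.
by apply: L_le_const; first exact: boundedN.
Qed.

Let bounded_Re (h : E) : bounded (fun y => complex.Re (set_val h y)).
Proof.
by have [c _ hc] := cl_bounded gA h; exists c => y; apply: le_trans (hc y); exact: ler_normcRe.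
Qed.

Let bounded_Im (h : E) : bounded (fun y => complex.Im (set_val h y)).
Proof.
by have [c _ hc] := cl_bounded gA h; exists c => y; apply: le_trans (hc y); exact: ler_normcIm.
Qed.

Let LRe_gelfand g : L (fun y => complex.Re (gelfand g y)) = complex.Re (gelfand g x).
Proof.
have bg := bounded_Re (clg g).
apply/eqP; rewrite eq_le L_le_Re//= -lerN2 -LN// -ReN -gelfandN.
apply: L_le_Re => [|y]; first exact: boundedN.
by rewrite gelfandN ReN.
Qed.

Let LRe (h : E) : L (fun y => complex.Re (set_val h y)) = complex.Re (set_val h x).
Proof.
have le (k : E) : L (fun y => complex.Re (set_val k y)) <= complex.Re (set_val k x).
  apply/ler_addgt0Pl => e e0; have e2 : 0 < e / 2 by lra.
  have [_ /(_ _ e2)[f fk]] := (clP (set_val k)).1 (set_valP k).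
  have close y : `|complex.Re (set_val k y) - complex.Re (gelfand f y)| < e / 2.
    by rewrite -ReB; apply: le_lt_trans (fk y); exact: ler_normcRe.
  have := close x; rewrite ltr_norml => /andP[kf _].
  have := @L_le_Re (fun y => complex.Re (set_val k y)) (f + (e / 2)%:C%C%:A) (bounded_Re k).
  rewrite gelfandD gelfandA ReD ReC => /(_ _)/Wrap[y|]; last lra.
  rewrite gelfandD gelfandA ReD ReC.
  by have := close y; rewrite ltr_norml => /andP[_]; lra.
apply/eqP; rewrite eq_le le/= -lerN2 -LN; last exact: bounded_Re.
have := le (axpy (-1) h (clg 0)); rewrite axpyE clgE gelfand0 addr0 mulN1r ReN.
congr (_ <= _); congr L; apply: funext => y.
by rewrite axpyE clgE gelfand0 addr0 mulN1r ReN.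
Qed.

Let LIm (h : E) : L (fun y => complex.Im (set_val h y)) = complex.Im (set_val h x).
Proof.
have := LRe (axpy (- 'i%C) h (clg 0)); rewrite axpyE clgE gelfand0 addr0 -Im_Re => <-.
by congr L; apply: funext => y; rewrite axpyE clgE gelfand0 addr0 -Im_Re.
Qed.

Let weight (w : M -> R^o) := forall y, 0 <= w y <= 1.

Let bounded_mul (w u : M -> R^o) : weight w -> bounded u -> bounded (fun y => w y * u y).
Proof.
move=> w01 [c uc]; exists c => y; rewrite normrM; have /andP[w0 w1] := w01 y.
apply: le_trans (uc y); rewrite (ger0_norm w0); exact: ler_piMl.
Qed.

Let bounded_weight w : weight w -> bounded w.
Proof. by move=> w01; exists 1 => y; have /andP[w0 w1] := w01 y; rewrite ger0_norm. Qed.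

Let weightC w : weight w -> weight (fun y => 1 - w y).
Proof. by move=> w01 y; have /andP[w0 w1] := w01 y; rewrite subr_ge0 w1 lerBlDr lerDl. Qed.

Let LC w u : weight w -> bounded u -> L u = L (fun y => w y * u y) + L (fun y => (1 - w y) * u y).
Proof.
move=> w01 bu; rewrite -LD; [|exact: bounded_mul|exact: bounded_mul (weightC w01) bu].
by congr L; apply: funext => y /=; rewrite -mulrDl addrC subrK mul1r.
Qed.

Let L_weight0 w u : weight w -> bounded u -> L w = 0 -> L (fun y => w y * u y) = 0.
Proof.
move=> w01 bu Lw; have [c uc] := bu; have bw := bounded_weight w01.
have bwu := bounded_mul w01 bu.
have le v : bounded v -> (forall y, `|v y| <= c) -> L (fun y => w y * v y) <= 0.
  move=> bv vc; have -> : 0 = L (c *: w) by rewrite LZ// Lw mulr0.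
  apply: L_mono => [||y]; [exact: bounded_mul|exact: boundedZ|].
  rewrite /= mulrC; apply: ler_wpM2r; first by case/andP: (w01 y).
  by apply: le_trans (vc y); exact: ler_norm.
apply/eqP; rewrite eq_le le//= -lerN2 oppr0 -LN//.
have := le (- u) (boundedN bu) => /(_ _)/Wrap[y|]; first by rewrite normrN.
by congr (_ <= _); congr L; apply: funext => y; rewrite /= mulrN.
Qed.

(** This is [h |-> L (w h) / L w], in real and imaginary parts since [L] acts on real functions. *)
Let normalized_state w := fun h : E =>
  ((L w)^-1 * L (fun y => w y * complex.Re (set_val h y)) +i*
   ((L w)^-1 * L (fun y => w y * complex.Im (set_val h y))))%C : R[i]^o.

Let Re_normalized w h : complex.Re (normalized_state w h) =
  (L w)^-1 * L (fun y => w y * complex.Re (set_val h y)).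
Proof. by []. Qed.

Let Im_normalized w h : complex.Im (normalized_state w h) =
  (L w)^-1 * L (fun y => w y * complex.Im (set_val h y)).
Proof. by []. Qed.

Let normalized_stateP w : weight w -> 0 < L w -> state_space (normalized_state w).
Proof.
move=> w01 Lw0; have bw := bounded_weight w01.
have bR h := bounded_mul w01 (bounded_Re h); have bI h := bounded_mul w01 (bounded_Im h).
apply: (state_of_monotone gA).
- move=> a h k; apply/eqP; rewrite eq_complex; case: a => p q /=.
  have bRh := boundedZ p (bR h); have bIh := boundedZ (- q) (bI h).
  have bRh' := boundedZ q (bR h); have bIh' := boundedZ p (bI h).
  apply/andP; split; apply/eqP.
    have -> : (fun y => w y * complex.Re (set_val (axpy (p +i* q)%C h k) y)) =
        ((p *: (fun y => w y * complex.Re (set_val h y))) +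
        (- q) *: (fun y => w y * complex.Im (set_val h y))) +
        (fun y => w y * complex.Re (set_val k y)).
      apply: funext => y; rewrite axpyE ReD.
      change (w y * (complex.Re ((p +i* q)%C * set_val h y) + complex.Re (set_val k y)) =
        p * (w y * complex.Re (set_val h y)) + (- q) * (w y * complex.Im (set_val h y)) +
        w y * complex.Re (set_val k y)).
      by case: (set_val h y) => c d /=; ring.
    rewrite !LD ?LZ//; [ring|exact: boundedD].
  have -> : (fun y => w y * complex.Im (set_val (axpy (p +i* q)%C h k) y)) =
      ((q *: (fun y => w y * complex.Re (set_val h y))) +
      p *: (fun y => w y * complex.Im (set_val h y))) +
      (fun y => w y * complex.Im (set_val k y)).
    apply: funext => y; rewrite axpyE ImD.
    change (w y * (complex.Im ((p +i* q)%C * set_val h y) + complex.Im (set_val k y)) =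
      q * (w y * complex.Re (set_val h y)) + p * (w y * complex.Im (set_val h y)) +
      w y * complex.Im (set_val k y)).
    by case: (set_val h y) => c d /=; ring.
  rewrite !LD ?LZ//; [ring|exact: boundedD].
- rewrite /normalized_state (_ : (fun y => _ * complex.Re _) = w); last first.
    by apply: funext => y; rewrite clgE gelfand1 mulr1.
  rewrite (_ : (fun y => _ * complex.Im _) = (fun=> 0)) ?L_const.
    by rewrite mulr0 mulVf// gt_eqF.
  by apply: funext => y; rewrite clgE gelfand1 mulr0.
- move=> h h0 /=; apply: mulr_ge0; first by rewrite invr_ge0 ltW.
  rewrite -(L_const 0); apply: L_mono => [||y]; [by exists 0 => y; rewrite normr0|exact: bR|].
  by rewrite mulr_ge0//; case/andP: (w01 y).
Qed.

(** The evaluation at [x] is the combination, with coefficients [L w] and [1 - L w], of the states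
    normalized by [w] and [1 - w]; by extremality both are the evaluation. If [L w] is 0 or 1, one
    of the two parts is killed by [L_weight0]. *)
Lemma representing_multiplicative w g : weight w ->
  L (fun y => w y * complex.Re (gelfand g y)) = L w * complex.Re (gelfand g x).
Proof.
move=> w01; have bw := bounded_weight w01; have bg := bounded_Re (clg g).
have LwC : L (fun y => 1 - w y) = 1 - L w.
  have := LC w01 (u := fun=> 1) _; rewrite L_const => /(_ _)/Wrap[|].
    by exists 1 => y; rewrite normr1.
  rewrite (_ : (fun y => w y * 1) = w); last by apply: funext => y; rewrite mulr1.
  rewrite (_ : (fun y => (1 - w y) * 1) = (fun y => 1 - w y)).
    by move=> LE; apply/eqP; rewrite eq_sym subr_eq addrC -LE.
  by apply: funext => y; rewrite mulr1.
have Lw0 : 0 <= L w.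
  rewrite -(L_const 0); apply: L_mono => // [|y]; first by exists 0 => y; rewrite normr0.
  by case/andP: (w01 y).
have Lw1 : L w <= 1 by apply: L_le_const => // y; case/andP: (w01 y).
have [Lw|Lwn0] := eqVneq (L w) 0; first by rewrite L_weight0// Lw mul0r.
have [Lw|Lwn1] := eqVneq (L w) 1.
  have := LC w01 bg; rewrite LRe Lw mul1r => ->.
  by rewrite (L_weight0 (weightC w01))// ?addr0// LwC Lw subrr.
have w_gt0 : 0 < L w by rewrite lt_def Lwn0.
have wC_gt0 : 0 < 1 - L w by rewrite subr_gt0 lt_def eq_sym Lwn1.
have LwCn0 : 1 - L w != 0 by rewrite gt_eqF.
have s1 := normalized_stateP w01 w_gt0.
have s2 : state_space (normalized_state (fun y => 1 - w y)).
  by apply: normalized_stateP; [exact: weightC|rewrite LwC].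
have [_ /(_ _ _ (L w) s1 s2)] := Chx.
have t01 : 0 < L w < 1 by rewrite w_gt0/= -subr_gt0.
have rep : evaluation x = (L w)%:C%C *: normalized_state w +
    (1 - L w)%:C%C *: normalized_state (fun y => 1 - w y).
  apply: funext => h; apply/eqP; rewrite eq_complex /evaluation.
  change ((complex.Re (set_val h x) == complex.Re ((L w)%:C%C * normalized_state w h +
     (1 - L w)%:C%C * normalized_state (fun y => 1 - w y) h)) &&
    (complex.Im (set_val h x) == complex.Im ((L w)%:C%C * normalized_state w h +
     (1 - L w)%:C%C * normalized_state (fun y => 1 - w y) h))).
  rewrite ReD ImD !ReZ !ImZ !Re_normalized !Im_normalized LwC.
  rewrite !(mulVKf Lwn0) !(mulVKf LwCn0).
  by apply/andP; split; apply/eqP; rewrite -?(LRe h) -?(LIm h); exact: LC.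
move=> /(_ t01 rep)[/(congr1 (fun F => F (clg g)))].
rewrite /normalized_state /evaluation clgE => /(congr1 (@complex.Re _)) /= <- _.
by rewrite mulrA mulfV// mul1r.
Qed.

(** [|k| = a Re k + b Im k] with [a = Re k / |k|] and [b = Im k / |k|] between -1 and 1, and a
    function with these bounds is [2 w - 1] for a weight [w]. *)
Lemma representing_normc k : gelfand k x = 0 -> L (fun y => normc (gelfand k y)) = 0.
Proof.
move=> kx.
have signed (v : M -> R^o) g : (forall y, -1 <= v y <= 1) -> gelfand g x = 0 ->
    bounded (fun y => v y * complex.Re (gelfand g y)) /\
    L (fun y => v y * complex.Re (gelfand g y)) = 0.
  move=> v11 gx; pose w y := (v y + 1) / 2.
  have w01 : weight w by move=> y; have /andP[v0 v1] := v11 y; rewrite /w; apply/andP; split; lra.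
  have bg := bounded_Re (clg g); have bwg := bounded_mul w01 bg.
  have -> : (fun y => v y * complex.Re (gelfand g y)) =
      2 *: (fun y => w y * complex.Re (gelfand g y)) + (- 1) *: (fun y => complex.Re (gelfand g y)).
    apply: funext => y; change (v y * complex.Re (gelfand g y) =
      2 * (w y * complex.Re (gelfand g y)) + (- 1) * complex.Re (gelfand g y)).
    by rewrite /w; field.
  split; first by apply: boundedD; exact: boundedZ.
  rewrite LD ?LZ//; [|exact: boundedZ|exact: boundedZ].
  rewrite representing_multiplicative// LRe_gelfand gx /= !mulr0 addr0//.
(* Where [k] vanishes, division by 0 gives 0, and the identity for [|k|] still holds. *)
pose a y : R^o := complex.Re (gelfand k y) / normc (gelfand k y).
pose b y : R^o := complex.Im (gelfand k y) / normc (gelfand k y).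
have quot (r n : R) : `|r| <= n -> -1 <= r / n <= 1.
  move=> rn; rewrite -ler_norml normrM normfV.
  have [->|n0] := eqVneq n 0; first by rewrite normr0 invr0 mulr0.
  have n_gt0 : 0 < n by rewrite lt_def n0/=; apply: le_trans rn.
  by rewrite (ger0_norm (ltW n_gt0)) ler_pdivrMr// mul1r.
have [bR LR] := signed a k (fun y => quot _ _ (ler_normcRe _)) kx.
have [|bI LI] := signed b (- 'i%C *: k) (fun y => quot _ _ (ler_normcIm _)).
  by rewrite gelfandZ kx mulr0.
have -> : (fun y => normc (gelfand k y)) =
    (fun y => a y * complex.Re (gelfand k y)) +
    (fun y => b y * complex.Re (gelfand (- 'i%C *: k) y)).
  apply: funext => y; change (normc (gelfand k y) = a y * complex.Re (gelfand k y) +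
    b y * complex.Re (gelfand (- 'i%C *: k) y)).
  rewrite gelfandZ -Im_Re /a /b mulrAC [X in _ + X]mulrAC -mulrDl -!expr2 -sqr_normcE.
  have [->|n0] := eqVneq (normc (gelfand k y)) 0; first by rewrite invr0 mulr0.
  by rewrite expr2 mulfK.
by rewrite LD// LR LI addr0.
Qed.

End representing_functional.

(** A functional that touches the envelope at the sum of the [|k|] vanishes there by
    [representing_normc]. So the envelope of the sum is 0, and it is an infimum over majorants
    [Re g]. *)
Lemma majorant_of_vanishing (ks : seq A) (e : R) : 0 < e ->
  (forall k, k \in ks -> gelfand k x = 0) ->
  exists2 g, forall k y, k \in ks -> normc (gelfand k y) <= complex.Re (gelfand g y) &
    complex.Re (gelfand g x) < e /\ forall y, 0 <= complex.Re (gelfand g y).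
Proof.
move=> e0 ksx.
have bk k : bounded (fun y => normc (gelfand k y)).
  have [c _ kc] := gelfand_bounded gA k; exists c => y.
  by rewrite ger0_norm ?normc_ge0.
pose u (s : seq A) : M -> R^o := \sum_(k <- s) (fun y => normc (gelfand k y)).
have u_cons k s : u (k :: s) = (fun y => normc (gelfand k y)) + u s by rewrite /u big_cons.
have bu s : bounded (u s).
  elim: s => [|k s IH]; last by rewrite u_cons; exact: boundedD.
  by rewrite /u big_nil; exists 0 => y; rewrite normr0.
have u0 s y : 0 <= u s y.
  elim: s => [|k s IH]; first by rewrite /u big_nil.
  by rewrite u_cons; apply: addr_ge0 => //; exact: normc_ge0.
have u_ge s k y : k \in s -> normc (gelfand k y) <= u s y.
  elim: s => [//|h s IH]; rewrite u_cons inE => /predU1P[->|/IH le].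
    by apply: (@le_trans _ _ (normc (gelfand h y) + u s y)) => //; rewrite lerDl.
  apply: (@le_trans _ _ (normc (gelfand h y) + u s y)) => //.
  by apply: ler_wpDl => //; exact: normc_ge0.
have [L [LD LZ Lle LE]] := hahn_banach boundedD boundedZ envelope_sublinear (bu ks).
have L0 : L (u ks) = 0.
  elim: ks ksx {LE} => [_|k s IH ksx].
    have := LZ 0 _ (bu [::]); rewrite scale0r mul0r => <-.
    by rewrite /u big_nil.
  rewrite u_cons LD// IH => [|h hs]; last by apply: ksx; rewrite inE hs orbT.
  by rewrite (representing_normc LD LZ Lle) ?addr0//; apply: ksx; rewrite inE eqxx.
have [_ [g /= ug <-]] := inf_adherent e0 (majorants_has (bu ks)).
rewrite -/(envelope _) -LE L0 add0r => ge; exists g => [k y kks|]; last split => // y.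
  by apply: le_trans (ug y); exact: u_ge.
by apply: le_trans (ug y).
Qed.

(* The values of [e] lie in the disc [|z - 1/2| <= 1/2], so that [|e y|]
   can be close to [1] only if [e y] is. *)
Theorem choquet_peaking (ks : seq A) (d : R) : 0 < d ->
  (forall k, k \in ks -> gelfand k x = 0) ->
  exists e : A, [/\ forall y, normc (gelfand e y) ^+ 2 <= complex.Re (gelfand e y),
    normc (gelfand e x - 1) <= d &
    forall k y, k \in ks -> normc (gelfand e y * gelfand k y) <= d].
Proof.
(* The bound [d^2] becomes [Re g0(x) / d <= d] after the division by [d]. *)
move=> d0 ksx; have [|g0 g0k [g0x g0_ge0]] := majorant_of_vanishing (e := d ^+ 2) _ ksx.
  by rewrite exprn_gt0.
pose g := g0 - ('i%C * (complex.Im (gelfand g0 x))%:C%C)%:A.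
have gE y : complex.Re (gelfand g y) = complex.Re (gelfand g0 y).
  by rewrite gelfandB gelfandA; case: (gelfand g0 y) (gelfand g0 x) => a b [p q] /=; ring.
have gx : gelfand g x = (complex.Re (gelfand g0 x))%:C%C.
  rewrite gelfandB gelfandA; case: (gelfand g0 x) => a b /=.
  by apply/eqP; rewrite eq_complex /=; apply/andP; split; apply/eqP; ring.
clearbody g.
(* For [e = 1 / z] and [Re z >= 1], [Re e = |e|^2 Re z >= |e|^2]; and [|k| <= Re g <= d |z|] gives
   [|e k| <= d]. *)
pose z := 1 + (d^-1)%:C%C *: g.
have zE y : gelfand z y = 1 + (d^-1)%:C%C * gelfand g y by rewrite gelfandD gelfand1 gelfandZ.
have dV0 : 0 < d^-1 by rewrite invr_gt0.
have zRe y : complex.Re (gelfand z y) = 1 + d^-1 * complex.Re (gelfand g0 y).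
  by rewrite zE ReD ReZ gE.
have z1 y : 1 <= complex.Re (gelfand z y).
  by rewrite zRe lerDl mulr_ge0// ltW.
have [e ez] : invertible z.
  apply: contrapT => nz; have [|y zy] := gA.2 z 0; first by rewrite /spectrum /= scale0r subr0.
  by have := z1 y; rewrite zy /=; lra.
clearbody z.
have eP y : gelfand e y * gelfand z y = 1 by rewrite -gelfandM ez gelfand1.
have e_disc y : normc (gelfand e y) ^+ 2 <= complex.Re (gelfand e y).
  rewrite sqr_normcE; have := z1 y; have := eP y.
  case: (gelfand e y) (gelfand z y) => a b [p q] /eqP.
  rewrite eq_complex /= => /andP[/eqP re /eqP im] p1.
  have aE : a = p * (a ^+ 2 + b ^+ 2).
    have -> : p * (a ^+ 2 + b ^+ 2) = a * (a * p - b * q) + b * (a * q + b * p) by ring.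
    by rewrite re im mulr1 mulr0 addr0.
  by rewrite [leRHS]aE ler_peMl// addr_ge0// sqr_ge0.
have e1 y : normc (gelfand e y) <= 1.
  have := e_disc y; have := ReleNormc (gelfand e y); have := normc_ge0 (gelfand e y); nra.
exists e; split=> // [|k y kks].
  have -> : gelfand e x - 1 = - ((d^-1)%:C%C * gelfand g x * gelfand e x).
    by rewrite -[X in _ - X](eP x) zE; ring.
  rewrite normcN gx !normcM !normc_real (ger0_norm (ltW dV0)) (ger0_norm (g0_ge0 x)).
  have : d^-1 * complex.Re (gelfand g0 x) <= d by rewrite ler_pdivrMl// -expr2 ltW.
  have := mulr_ge0 (ltW dV0) (g0_ge0 x).
  have := e1 x; have := normc_ge0 (gelfand e x).
  move: (d^-1 * _) (normc _) => p n n0 n1 p0 pd; nra.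
rewrite normcM; have ez1 : normc (gelfand e y) * normc (gelfand z y) = 1.
  by rewrite -normcM eP normc1.
have kz : normc (gelfand k y) <= d * normc (gelfand z y).
  apply: le_trans (g0k k y kks) _; rewrite -ler_pdivrMl//.
  by apply: le_trans (ReleNormc _); rewrite zRe lerDr.
have := normc_ge0 (gelfand e y); nra.
Qed.

End peaking.

(** * The spectral radius as a maximum over the Choquet boundary *)

Section spectral_radius.
Variables (R : realType) (A : comAlgType R[i]).
Hypothesis gA : gelfand_algebra A.
Implicit Types (f g k : A) (x y : maxspace A).
Local Notation rho := spectral_radius.

Let moduli_has f : has_sup [set normc z | z in spectrum f].
Proof.
split.
  have [|x _] := gA.2 (0 : A) 0.
    by move=> [g]; rewrite scale0r subr0 mulr0 => /esym/eqP; rewrite oner_eq0.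
  by exists (normc (gelfand f x)), (gelfand f x) => //; exact: gelfand_in_spectrum.
have [c _ fc] := gelfand_bounded gA f; exists c => _ [z fz <-].
by have [x <-] := gA.2 _ _ fz.
Qed.

Lemma le_rho f x : normc (gelfand f x) <= rho f.
Proof.
apply: ub_le_sup; first by case: (moduli_has f).
by exists (gelfand f x) => //; exact: gelfand_in_spectrum.
Qed.

Lemma peripheral_attained f z : peripheral_spectrum f z ->
  exists2 y, Ch (cl A) y & gelfand f y = z.
Proof.
move=> [fz zr]; have [x xz] := gA.2 _ _ fz; rewrite -xz.
by apply: (choquet_boundary gA) => y; rewrite xz zr; exact: le_rho.
Qed.

(** Compactness gives a character that maximizes [|f|], and [choquet_boundary] replaces it by one in
    the boundary. *)
Lemma rho_attained f : exists2 y, Ch (cl A) y & normc (gelfand f y) = rho f.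
Proof.
have clos c : closed [set x | c <= normc (gelfand f x)].
  move=> x clx; rewrite /= leNgt; apply/negP => fx.
  have e0 : 0 < c - normc (gelfand f x) by rewrite subr_gt0.
  have [y [/= cy yx]] := clx _ (nbhs_gelfand f x e0).
  have := normcD (gelfand f y - gelfand f x) (gelfand f x); rewrite subrK; lra.
have [_ [z fz _]] := (moduli_has f).1; have [x0 _] := gA.2 _ _ fz.
have [|y _|y w _ _|y _|x xP] := @compact_directed _ (maxspace A) setT
  (fun y => [set x | normc (gelfand f y) <= normc (gelfand f x)]) gA.1.
- by exists x0.
- exact: clos.
- have [yw|/ltW wy] := leP (normc (gelfand f y)) (normc (gelfand f w)).
    by exists w => // v /= wv; split => //=; exact: le_trans wv.
  by exists y => // v /= yv; split => //=; exact: le_trans yv.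
- by exists y => /=.
have [y Chy fy] : exists2 y, Ch (cl A) y & gelfand f y = gelfand f x.
  by apply: (choquet_boundary gA) => y; exact: xP.
exists y => //; rewrite fy; apply/eqP; rewrite eq_le le_rho/=.
apply: ge_sup; first by case: (moduli_has f).
by move=> _ [v fv <-]; have [w <-] := gA.2 _ _ fv; exact: xP.
Qed.

Lemma rho_le f c : (forall y, normc (gelfand f y) <= c) -> rho f <= c.
Proof. by move=> fc; have [y _ <-] := rho_attained f. Qed.

Lemma rho_ge0 f : 0 <= rho f.
Proof. by have [y _ <-] := rho_attained f; exact: normc_ge0. Qed.

Lemma rhoD f g : rho (f + g) <= rho f + rho g.
Proof.
apply: rho_le => y; rewrite gelfandD; apply: le_trans (normcD _ _) _.
by apply: lerD; exact: le_rho.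
Qed.

Lemma rhoM f g : rho (f * g) <= rho f * rho g.
Proof.
apply: rho_le => y; rewrite gelfandM normcM.
by apply: ler_pM; rewrite ?normc_ge0 ?le_rho.
Qed.

Lemma rhoZ z f : rho (z *: f) = normc z * rho f.
Proof.
apply/eqP; rewrite eq_le; apply/andP; split.
  by apply: rho_le => y; rewrite gelfandZ normcM ler_wpM2l ?normc_ge0 ?le_rho.
by have [y _ <-] := rho_attained f; rewrite -normcM -gelfandZ; exact: le_rho.
Qed.

Lemma rhoA z : rho (z%:A : A) = normc z.
Proof.
by have [y _ <-] := rho_attained (z%:A : A); rewrite gelfandA.
Qed.

Lemma rhoN f : rho (- f) = rho f.
Proof. by rewrite -scaleN1r rhoZ normcN normc1 mul1r. Qed.

Lemma rhoB f g : rho (f - g) <= rho f + rho g.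
Proof. by rewrite -[rho g]rhoN; exact: rhoD. Qed.

Lemma rho_sqr f : rho (f * f) = rho f ^+ 2.
Proof.
apply/eqP; rewrite eq_le expr2 rhoM/=; have [y _ <-] := rho_attained f.
by rewrite -normcM -gelfandM; exact: le_rho.
Qed.

Lemma rho_sub_const f z : `|rho (f - z%:A) - rho f| <= normc z.
Proof.
have := rhoB f z%:A; have := rhoD (f - z%:A) z%:A; rewrite subrK rhoA => ? ?.
by rewrite ler_norml; apply/andP; split; lra.
Qed.

End spectral_radius.

Lemma eq_of_scaled_small (R : realType) (a b K : R) :
  (forall e, 0 < e <= 1 -> `|a - b| <= K * e) -> a = b.
Proof.
move=> small; apply/eqP; rewrite -subr_eq0 -normr_eq0 eq_le normr_ge0 andbT.
apply/ler_addgt0Pl => e e0; rewrite addr0.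
have K0 : 0 <= K by have := small 1; rewrite ltr01 lexx mulr1 => /(_ isT); apply: le_trans.
have K1 : 0 < K + 1 by rewrite ltr_wpDl.
pose d := Num.min 1 (e / (K + 1)).
have d0 : 0 < d by rewrite lt_min ltr01 divr_gt0.
have d1 : d <= 1 by rewrite ge_min lexx.
have de : d * (K + 1) <= e by rewrite -ler_pdivlMr// ge_min lexx orbT.
apply: le_trans (small d _) _; first by rewrite d0.
by rewrite mulrC; lra.
Qed.

(** * Surjections with a peripheral spectrum condition *)

(* The relation is the graph of the surjection, or its converse. *)
Section modulus_correspondence.
Variables (R : realType) (A B : comAlgType R[i]).
Hypotheses (gA : gelfand_algebra A) (gB : gelfand_algebra B).
Variable Rel : A -> B -> Prop.
Hypothesis Rel_left : forall f, exists b, Rel f b.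
Hypothesis Rel_right : forall b, exists f, Rel f b.
Local Notation rho := spectral_radius.
Hypothesis Rel_rho : forall f b f' b', Rel f b -> Rel f' b' -> rho (f * f') = rho (b * b').

Let Rel_norm f b : Rel f b -> rho f = rho b.
Proof.
move=> fb; have := Rel_rho fb fb; rewrite (rho_sqr gA) (rho_sqr gB) => /eqP.
by rewrite eqrXn2// ?(rho_ge0 gA) ?(rho_ge0 gB)// => /eqP.
Qed.

Let peak (C : comAlgType R[i]) (gC : gelfand_algebra C) (x : maxspace C) (ks : seq C) (d : R) :
  Ch (cl C) x -> 0 < d -> (forall k, k \in ks -> gelfand k x = 0) ->
  exists e : C, [/\ rho e <= 1, 1 - d <= normc (gelfand e x) &
    forall k, k \in ks -> rho (e * k) <= d].
Proof.
move=> Chx d0 ksx; have [e [disc ex ek]] := choquet_peaking gC Chx d0 ksx; exists e; split.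
- apply: (rho_le gC) => y; have := disc y; have := ReleNormc (gelfand e y).
  have := normc_ge0 (gelfand e y); nra.
- have := normcB (gelfand e x) (gelfand e x - 1); rewrite subKr normc1; lra.
- by move=> k kks; apply: (rho_le gC) => y; rewrite gelfandM; exact: ek.
Qed.

(** [x] is a cluster point of boundary points where the partners [h] of elements peaking at [y] have
    modulus nearly 1. At these points [|f|] is compared with [|b(y)|]: from above through
    [rho (f h)], from below through an element peaking at the point. *)
Lemma matching_point (y : maxspace B) : Ch (cl B) y ->
  exists2 x, Ch (cl A) x & forall f b, Rel f b -> normc (gelfand f x) = normc (gelfand b y).
Proof.
move=> Chy.
(* Finitely many elements vanishing at [y], with a tolerance; concatenation and minimum make the
   closures of the [W i] directed. *)
pose D := [set i : seq B * R | 0 < i.2 /\ forall k, k \in i.1 -> gelfand k y = 0].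
(* Only boundary points are kept, since the lower bound needs peaking elements there. *)
pose W (i : seq B * R) := [set x | Ch (cl A) x /\ exists h b, [/\ Rel h b, rho b <= 1,
  forall k, k \in i.1 -> rho (b * k) <= i.2 & 1 - i.2 <= normc (gelfand h x)]].
have [|i _|[ks d] [ks' d'] [/= d0 ksy] [/= d'0 ks'y]|[ks d] [/= d0 ksy]|x xP] :=
  @compact_directed _ _ D (fun i => closure (W i)) gA.1.
- by exists ([::], 1).
- exact: closed_closure.
- exists (ks ++ ks', Num.min d d').
    split=> /= [|k]; first by rewrite lt_min d0.
    by rewrite mem_cat => /orP[]; [exact: ksy|exact: ks'y].
  have sub (i : seq B * R) : Num.min d d' <= i.2 -> {subset i.1 <= ks ++ ks'} ->
      closure (W (ks ++ ks', Num.min d d')) `<=` closure (W i).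
    move=> di iks; apply: closure_subset => w [Chw [h [b [hb b1 bk hw]]]].
    split=> //; exists h, b; split=> //; last by apply: le_trans hw; rewrite lerD2l lerN2.
    by move=> k /iks ki; apply: le_trans di; exact: bk.
  move=> w Ww; split; apply: sub Ww => /=; rewrite ?ge_min ?lexx ?orbT// => k kk.
    by rewrite mem_cat kk.
  by rewrite mem_cat kk orbT.
- have [b [b1 bx bk]] := peak gB Chy d0 ksy; have [h hb] := Rel_right b.
  have [w Chw hw] := rho_attained gA h; exists w; apply: subset_closure; split=> //.
  by exists h, b; split=> //=; rewrite hw (Rel_norm hb); apply: le_trans bx _; exact: (le_rho gB).
have match_x f b : Rel f b -> normc (gelfand f x) = normc (gelfand b y).
  move=> fb; set c := normc (gelfand b y); have c0 : 0 <= c by exact: normc_ge0.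
  apply: (@eq_of_scaled_small _ _ _ (4 + 2 * c + rho f)) => e /andP[e0 e1].
  pose k := b - (gelfand b y)%:A.
  have ky : forall k', k' \in [:: k] -> gelfand k' y = 0.
    by move=> k'; rewrite inE => /eqP ->; rewrite gelfandB gelfandA subrr.
  have [x' [[Chx' [h [b1 [hb1 b1_le1 b1k hx']]]] /= x'x]] :=
    xP ([:: k], e) (conj e0 ky) _ (nbhs_gelfand f x e0).
  have {b1k} b1k : rho (b1 * k) <= e by apply: b1k; rewrite inE.
  rewrite /= in hx'.
  have bE : (gelfand b y)%:A = b - k by rewrite /k; ring.
  have fx'_F := le_rho gA f x'.
  have upper : normc (gelfand f x') * (1 - e) <= c + e.
    apply: (@le_trans _ _ (rho (f * h))).
      apply: le_trans (le_rho gA _ x'); rewrite gelfandM normcM.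
      by rewrite ler_wpM2l ?normc_ge0.
    rewrite (Rel_rho fb hb1); have -> : b * b1 = gelfand b y *: b1 + b1 * k.
      by rewrite -mulr_algl bE; ring.
    apply: le_trans (rhoD gB _ _) _; rewrite (rhoZ gB); apply: lerD => //.
    exact: ler_piMr.
  (* For [p] peaking at [x'], [rho (bp b) = rho (p f)] is at most [|f(x')| + e], while
     [rho (bp b1) = rho (p h)] is nearly 1 and [b] acts on [b1] nearly as the scalar [b(y)]. *)
  have lower : c * (1 - e) ^+ 2 <= normc (gelfand f x') + 2 * e.
    have [|p [p1 px' pk]] := @peak A gA x' [:: f - (gelfand f x')%:A] e Chx' e0.
      by move=> k'; rewrite inE => /eqP ->; rewrite gelfandB gelfandA subrr.
    have {pk} pk : rho (p * (f - (gelfand f x')%:A)) <= e by apply: pk; rewrite inE.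
    have [bp pbp] := Rel_left p.
    have pf : rho (bp * b) <= normc (gelfand f x') + e.
      rewrite -(Rel_rho pbp fb).
      have -> : p * f = gelfand f x' *: p + p * (f - (gelfand f x')%:A).
        by rewrite -[gelfand f x' *: p]mulr_algl; ring.
      apply: le_trans (rhoD gA _ _) _; rewrite (rhoZ gA); apply: lerD => //.
      by rewrite ler_piMr ?normc_ge0.
    have e1' : 0 <= 1 - e by rewrite subr_ge0.
    have ph : (1 - e) ^+ 2 <= rho (bp * b1).
      rewrite -(Rel_rho pbp hb1); apply: le_trans (le_rho gA _ x').
      by rewrite gelfandM normcM expr2; exact: ler_pM.
    have bp1 : rho bp <= 1 by rewrite -(Rel_norm pbp).
    apply: (@le_trans _ _ (c * rho (bp * b1))); first by rewrite ler_wpM2l.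
    rewrite -(rhoZ gB); have -> : gelfand b y *: (bp * b1) = (bp * b) * b1 - bp * (b1 * k).
      by rewrite -mulr_algl bE; ring.
    apply: le_trans (rhoB gB _ _) _.
    have : rho (bp * b * b1) <= rho (bp * b).
      by apply: le_trans (rhoM gB _ _) _; rewrite ler_piMr ?(rho_ge0 gB).
    have : rho (bp * (b1 * k)) <= e.
      apply: le_trans (rhoM gB _ _) _; apply: le_trans b1k.
      by rewrite ler_piMl ?(rho_ge0 gB).
    lra.
  have : normc (gelfand f x') <= rho f by [].
  have := normc_ge0 (gelfand f x').
  have := normcD (gelfand f x' - gelfand f x) (gelfand f x); rewrite subrK.
  have := normcB (gelfand f x') (gelfand f x' - gelfand f x); rewrite subKr.
  move: x'x upper lower c0.
  move: (normc (gelfand f x')) (normc (_ - _)) (normc (gelfand f x)) => a t n.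
  move=> te up lo c0 na an a0 aF; rewrite ler_norml; apply/andP; split; nra.
(* Partners of elements peaking at [y] satisfy the criterion at [x], because products keep their
   spectral radius. *)
exists x => //; apply: (choquet_of_peaking gA) => k kx d d0.
have [kb kkb] := Rel_left k.
have kby : forall k', k' \in [:: kb] -> gelfand k' y = 0.
  move=> k'; rewrite inE => /eqP ->; apply/eqP; rewrite -normc_eq0.
  by rewrite -(match_x _ _ kkb) kx normc0.
have [b [b1 by1 bk]] := peak gB Chy d0 kby; have [h hb] := Rel_right b.
exists h; split=> [w||w].
- by apply: le_trans (le_rho gA _ _) _; rewrite (Rel_norm hb).
- by rewrite (match_x _ _ hb).
- rewrite -gelfandM; apply: le_trans (le_rho gA _ _) _.
  by rewrite (Rel_rho hb kkb); apply: bk; rewrite inE.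
Qed.

End modulus_correspondence.

Lemma disc_half (R : realType) (z : R[i]) :
  normc z ^+ 2 <= complex.Re z -> normc (z - 2^-1) <= 2^-1.
Proof.
move=> disc; have half : (2^-1 : R[i]) = (2^-1 : R)%:C%C by rewrite fmorphV rmorph_nat.
rewrite -ler_sqr ?nnegrE ?normc_ge0 ?invr_ge0// half; move: disc; rewrite !sqr_normcE.
by case: z => a b /=; nra.
Qed.

Lemma disc_near1 (R : realType) (z : R[i]) (d : R) : 0 <= d ->
  normc z ^+ 2 <= complex.Re z -> 1 - d <= normc z -> normc (1 - z) ^+ 2 <= 2 * d.
Proof.
move=> d0 disc dz.
have -> : normc (1 - z) ^+ 2 = 1 - 2 * complex.Re z + normc z ^+ 2.
  by rewrite !sqr_normcE; case: z {disc dz} => p q /=; ring.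
have := normc_ge0 z; nra.
Qed.

(** The triangle inequality allows at most [|w| / 2 + |a| = 3/2 |a|], with equality only for [w]
    opposite to [a]. *)
Lemma eqN_of_max_dist (R : realType) (w a : R[i]) : normc w = normc a ->
  3 / 2 * normc a <= normc (w / 2 - a) -> w = - a.
Proof.
move=> wa; have na := normc_ge0 a.
have half : (2^-1 : R[i]) = (2^-1 : R)%:C%C by rewrite fmorphV rmorph_nat.
rewrite -ler_sqr ?nnegrE ?normc_ge0 ?mulr_ge0// exprMn !sqr_normcE [w / 2]mulrC half ReB ReZ.
have := congr1 (fun t => t ^+ 2) wa; rewrite !sqr_normcE.
case: w a {wa na half} => p q [r s] /= e; rewrite mul0r addr0 => le.
have : (p + r) ^+ 2 + (q + s) ^+ 2 <= 0 by nra.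
have := sqr_ge0 (p + r); have := sqr_ge0 (q + s) => ? ? ?.
have /eqP : (p + r) ^+ 2 = 0 by lra.
have /eqP : (q + s) ^+ 2 = 0 by lra.
rewrite !sqrf_eq0 !addr_eq0 => /eqP -> /eqP ->.
by apply/eqP; rewrite eq_complex /= !eqxx.
Qed.

(** * From equal moduli to equal values *)

Section peripherally_multiplicative.
Variables (R : realType) (A B : comAlgType R[i]).
Hypotheses (gA : gelfand_algebra A) (gB : gelfand_algebra B).
Variables (S : A -> B) (alpha : R[i]).
Hypothesis S_onto : forall b, exists f, S f = b.
Hypothesis alpha_neq0 : alpha != 0.
Hypothesis S_spectrum : forall f g,
  peripheral_spectrum (S f * S g - alpha%:A) `&`
    peripheral_spectrum (f * g - alpha%:A) !=set0.
Local Notation rho := spectral_radius.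
Implicit Types (f g : A) (x : maxspace A) (y : maxspace B) (b : B).

Lemma rho_alpha f g : rho (S f * S g - alpha%:A) = rho (f * g - alpha%:A).
Proof. by have [z [[_ <-] [_ <-]]] := S_spectrum f g. Qed.

Let c2 := 2 * normc alpha.

Let rho_near f g : `|rho (S f * S g) - rho (f * g)| <= c2.
Proof.
have := rho_sub_const gB (S f * S g) alpha; have := rho_sub_const gA (f * g) alpha.
rewrite rho_alpha !ler_norml => /andP[l1 u1] /andP[l2 u2]; rewrite /c2.
by apply/andP; split; lra.
Qed.

Let archimedean_eq0 (a c : R) : (forall n : nat, n.+1%:R * `|a| <= c) -> a = 0.
Proof.
move=> ac; apply/eqP; rewrite -normr_eq0; apply: contraT => a0.
have a_gt0 : 0 < `|a| by rewrite lt_def a0 normr_ge0.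
have c0 : 0 <= c / `|a|.
  by rewrite divr_ge0// ?normr_ge0//; apply: le_trans (ac 0%N); rewrite mul1r.
have lt := archi_boundP c0; have := ac (Num.bound (c / `|a|)).
rewrite -ler_pdivlMr// => le; have := lt_le_trans lt (le_trans _ le).
by rewrite ltxx => -> //; rewrite ler_nat.
Qed.

(* [S] is not assumed homogeneous; scaling the second factor in [rho_near]
   through the surjectivity of [S] removes its bounded error. *)
Let rho_scale n f b : rho (S (n.+1%:R%:C%C *: f) * b) = n.+1%:R * rho (S f * b).
Proof.
have near := rho_near; move: (c2) near => c near.
apply/eqP; rewrite -subr_eq0; apply/eqP.
apply: (@archimedean_eq0 _ (c + n.+1%:R * c)) => m.
rewrite -[X in X * _ <= _](ger0_norm (ler0n R m.+1)) -normrM.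
have [g gE] := S_onto (m.+1%:R%:C%C *: b).
have := near f g; have := near (n.+1%:R%:C%C *: f) g; rewrite gE.
rewrite -!scalerAr -scalerAl !(rhoZ gB) !(rhoZ gA) !normc_real !(ger0_norm (ler0n R _)).
have n0 : 0 <= n.+1%:R :> R by []. have m0 : 0 <= m.+1%:R :> R by [].
rewrite !ler_norml.
move: n0 m0; move: n.+1%:R m.+1%:R (rho _) (rho (S f * b)) (rho (f * g)) => N M r s t N0 M0.
move=> /andP[l1 u1] /andP[l2 u2].
have := mulr_ge0 N0 (_ : 0 <= c - (M * s - t)); rewrite subr_ge0 => /(_ u2) ?.
have := mulr_ge0 N0 (_ : 0 <= (M * s - t) + c); rewrite -lerBlDr sub0r => /(_ l2) ?.
by apply/andP; split; lra.
Qed.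

(** Scaling [f] by [n + 1] multiplies the difference of the two sides by [n + 1], by [rho_scale],
    while [rho_near] keeps it bounded. *)
Lemma rho_multiplicative f g : rho (f * g) = rho (S f * S g).
Proof.
have near := rho_near; move: (c2) near => c near.
apply/eqP; rewrite eq_sym -subr_eq0; apply/eqP; apply: (@archimedean_eq0 _ c) => n.
have := near (n.+1%:R%:C%C *: f) g.
rewrite rho_scale -scalerAl (rhoZ gA) normc_real (ger0_norm (ler0n R _)).
by rewrite -mulrBr normrM (ger0_norm (ler0n R _)).
Qed.

Definition matched x y := forall f, normc (gelfand f x) = normc (gelfand (S f) y).

Lemma matched_right y : Ch (cl B) y -> exists2 x, Ch (cl A) x & matched x y.
Proof.
move=> Chy.
have [f|b|f b f' b' <- <-|x Chx xP] := @matching_point _ A B gA gB (fun f b => S f = b) _ _ _ y Chy.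
- by exists (S f).
- exact: S_onto.
- exact: rho_multiplicative.
by exists x => // f; exact: xP.
Qed.

Lemma matched_left x : Ch (cl A) x -> exists2 y, Ch (cl B) y & matched x y.
Proof.
move=> Chx.
have [b|f|b f b' f' <- <-|y Chy yP] := @matching_point _ B A gB gA (fun b f => S f = b) _ _ _ x Chx.
- exact: S_onto.
- by exists (S f).
- by rewrite rho_multiplicative.
by exists y => // f; rewrite (yP (S f) f).
Qed.

(** [f - f(x')] vanishes at [x'], so its image vanishes at [y], so it vanishes at [x]. *)
Lemma matched_unique_left x x' y : matched x y -> matched x' y -> x = x'.
Proof.
move=> xy x'y; apply: gelfand_inj => f; apply/eqP; rewrite -subr_eq0 -normc_eq0.
have : normc (gelfand (f - (gelfand f x')%:A) x) = 0.
  by rewrite xy -x'y gelfandB gelfandA subrr normc0.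
by rewrite gelfandB gelfandA => ->.
Qed.

Lemma matched_unique_right x y y' : matched x y -> matched x y' -> y = y'.
Proof.
move=> xy xy'; apply: gelfand_inj => b; apply/eqP; rewrite -subr_eq0 -normc_eq0.
have [f fE] := S_onto (b - (gelfand b y')%:A).
have : normc (gelfand (S f) y) = 0.
  by rewrite -xy xy' fE gelfandB gelfandA subrr normc0.
by rewrite fE gelfandB gelfandA => ->.
Qed.

Section at_matched_point.
Variables (x : maxspace A) (y : maxspace B).
Hypotheses (Chy : Ch (cl B) y) (xy : matched x y).

(* If [lam * S f1 y = - alpha] and [b] peaks at [y], the spectral radius of
   [S f1 * (lam b) - alpha] is almost the largest possible value [2 |alpha|];
   [rho_alpha] transfers this to [f1], then to [f2] and back to [S f2]. *)
Lemma value_determined f1 f2 : gelfand f1 x = gelfand f2 x ->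
  gelfand (S f1) y = gelfand (S f2) y.
Proof.
move=> f12; set z1 := gelfand (S f1) y; set z2 := gelfand (S f2) y.
have n12 : normc z1 = normc z2 by rewrite -!xy f12.
have [z10|z1n0] := eqVneq z1 0.
  by move: n12; rewrite z10 normc0 => /esym/eqP; rewrite normc_eq0 => /eqP ->.
pose lam := - alpha / z1.
have lamz1 : lam * z1 = - alpha by rewrite divfK.
have nlam : normc (lam * z2) = normc alpha by rewrite normcM -n12 -normcM lamz1 normcN.
suff : lam * z2 = - alpha.
  rewrite -lamz1 => /mulfI -> //.
  by rewrite mulf_neq0 ?oppr_eq0 ?invr_eq0.
apply: (eqN_of_max_dist nlam).
(* [k3] vanishes at [y] because [f2 - f1] vanishes at [x]; it controls the exchange of [f1] for
   [f2], as [rho (g (f2 - f1)) = rho (S g k3)]. *)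
pose k1 := S f1 - z1%:A; pose k2 := S f2 - z2%:A; pose k3 := S (f2 - f1).
apply/ler_addgt0Pl => e e0.
(* The peak costs [|alpha| d], and each of the three exchanges costs [|lam| d]. *)
pose d := e / (normc alpha + 3 * normc lam + 1).
have den0 : 0 < normc alpha + 3 * normc lam + 1.
  by have := normc_ge0 alpha; have := normc_ge0 lam; lra.
have d0 : 0 < d by rewrite divr_gt0.
have dE : d * (normc alpha + 3 * normc lam + 1) = e by rewrite divfK// gt_eqF.
have [|b [disc by1 bk]] := choquet_peaking gB Chy (ks := [:: k1; k2; k3]) d0.
  move=> k; rewrite !inE => /or3P[] /eqP ->; rewrite ?gelfandB ?gelfandA ?subrr//.
  by apply/eqP; rewrite -normc_eq0 -xy gelfandB f12 subrr normc0.
have rho_bk k : k \in [:: k1; k2; k3] -> rho (lam *: b * k) <= normc lam * d.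
  move=> kks; rewrite -scalerAl (rhoZ gB) ler_wpM2l ?normc_ge0//.
  by apply: (rho_le gB) => w; rewrite gelfandM; exact: bk.
have [g gE] := S_onto (lam *: b).
have lamb : lam *: b = lam%:A * b by rewrite mulr_algl.
have lam_mulb z : (lam * z) *: b = lam%:A * (z%:A * b) by rewrite !mulr_algl scalerA.
have step1 : normc alpha * (2 - d) <= rho ((lam * z1) *: b - alpha%:A).
  apply: le_trans (le_rho gB _ y); rewrite gelfandB gelfandZ gelfandA lamz1.
  have -> : - alpha * gelfand b y - alpha = - (alpha * (2 + (gelfand b y - 1))) by ring.
  rewrite normcN normcM ler_wpM2l ?normc_ge0//.
  have := normcD_rev 2 (gelfand b y - 1).
  have -> : normc (2 : R[i]) = 2.
    by rewrite -[2]/(2%:R) -(rmorph_nat (real_complex R)) normc_real ger0_norm.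
  lra.
have step2 : rho ((lam * z1) *: b - alpha%:A) <= rho (S f1 * S g - alpha%:A) + normc lam * d.
  have -> : (lam * z1) *: b - alpha%:A = (S f1 * S g - alpha%:A) - lam *: b * k1.
    by rewrite lam_mulb gE lamb /k1; ring.
  by apply: le_trans (rhoB gB _ _) _; rewrite lerD2l rho_bk// !inE eqxx.
have step3 : rho (f1 * g - alpha%:A) <= rho (f2 * g - alpha%:A) + normc lam * d.
  have -> : f1 * g - alpha%:A = (f2 * g - alpha%:A) - g * (f2 - f1) by ring.
  apply: le_trans (rhoB gA _ _) _.
  by rewrite lerD2l rho_multiplicative gE rho_bk// !inE eqxx !orbT.
have step4 : rho (S f2 * S g - alpha%:A) <= rho ((lam * z2) *: b - alpha%:A) + normc lam * d.
  have -> : S f2 * S g - alpha%:A = ((lam * z2) *: b - alpha%:A) + lam *: b * k2.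
    by rewrite lam_mulb gE lamb /k2; ring.
  by apply: le_trans (rhoD gB _ _) _; rewrite lerD2l rho_bk// !inE eqxx orbT.
(* The values of [b] lie in the disc of centre and radius 1/2, so those of [lam z2 b] lie within
   [|alpha| / 2] of [lam z2 / 2]. *)
have step5 : rho ((lam * z2) *: b - alpha%:A) <= normc (lam * z2 / 2 - alpha) + normc alpha / 2.
  apply: (rho_le gB) => w; rewrite gelfandB gelfandZ gelfandA.
  have -> : lam * z2 * gelfand b w - alpha =
      (lam * z2 / 2 - alpha) + lam * z2 * (gelfand b w - 2^-1) by ring.
  apply: le_trans (normcD _ _) _; rewrite lerD2l normcM nlam.
  by rewrite ler_wpM2l ?normc_ge0// disc_half.
rewrite !rho_alpha in step2 step4; lra.
Qed.

(** On the side of [A] the spectral radius is that of a scalar. On the side of [B] it only bounds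
    the value at [y], since images of constants are not known to be constant. *)
Lemma const_product_dist (u v : R[i]) :
  normc (gelfand (S u%:A) y * gelfand (S v%:A) y - alpha) <= normc (u * v - alpha).
Proof.
rewrite -gelfandM -[X in normc (_ - X) <= _](gelfandA (A := B) alpha y) -gelfandB.
apply: le_trans (le_rho gB _ _) _.
by rewrite rho_alpha -scalerAl mul1r scalerA -scalerBl (rhoA gA).
Qed.

(** Multiply by the value at [y] of the image of [w], where [v w = alpha]: its modulus is [|w|], and
    its product with the value for [v] is exactly [alpha]. *)
Lemma const_lipschitz (u v : R[i]) :
  normc (gelfand (S u%:A) y - gelfand (S v%:A) y) <= normc (u - v).
Proof.
have nS w : normc (gelfand (S w%:A) y) = normc w by rewrite -xy gelfandA.
have [->|v0] := eqVneq v 0.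
  have -> : gelfand (S 0%:A) y = 0 by apply/eqP; rewrite -normc_eq0 nS normc0.
  by rewrite !subr0 nS.
pose w := alpha / v; have vw : v * w = alpha by rewrite mulrC divfK.
have w0 : 0 < normc w by rewrite normc_gt0 mulf_neq0 ?invr_eq0.
have Svw : gelfand (S v%:A) y * gelfand (S w%:A) y = alpha.
  apply/eqP; rewrite -subr_eq0 -normc_eq0 eq_le normc_ge0 andbT.
  by apply: le_trans (const_product_dist _ _) _; rewrite vw subrr normc0.
rewrite -(ler_pM2r w0) -{1}(nS w) -!normcM !mulrBl Svw vw.
exact: const_product_dist.
Qed.

End at_matched_point.

(** The common peripheral point [z] is attained at some [y'] that need not be near [y]. The two are
    tied by [k], the preimage of [S 1 S u - c], which vanishes at [x]: [p] is small where [k] is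
    not, and [|p|] is nearly 1 at the partner [x'] of [y'], so [S 1 S u] is close to [c] at [y']
    too. *)
Lemma const_value x y u : Ch (cl A) x -> Ch (cl B) y -> matched x y ->
  gelfand (S 1) y * gelfand (S u%:A) y = u.
Proof.
move=> Chx Chy xy.
have S1E : S 1 = S 1%:A by rewrite scale1r.
have [->|ua] := eqVneq u alpha.
  apply/eqP; rewrite -subr_eq0 -normc_eq0 eq_le normc_ge0 andbT S1E.
  by apply: le_trans (const_product_dist y _ _) _; rewrite mul1r subrr normc0.
set c := _ * _; have [k kE] := S_onto (S 1 * S u%:A - c%:A).
pose D := normc (u - alpha).
have D0 : 0 < D by rewrite normc_gt0 subr_eq0.
suff cu : normc (u - c) = 0 by apply/eqP; rewrite eq_sym -subr_eq0 -normc_eq0 cu.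
apply: (@eq_of_scaled_small _ _ _ (2 * D + 1)) => e /andP[e0 e1].
rewrite subr0 ger0_norm ?normc_ge0//.
(* [disc_near1] turns [|p| >= 1 - d] into [|1 - p|^2 <= 2 d = e^2]. *)
pose d := e ^+ 2 / 2; have d0 : 0 < d by rewrite divr_gt0// exprn_gt0.
have d_half : d <= 2^-1 by rewrite /d ler_pdivrMr// mulVf// expr2 mulr_ile1// ltW.
have kx : forall k', k' \in [:: k] -> gelfand k' x = 0.
  move=> k'; rewrite inE => /eqP ->; apply/eqP; rewrite -normc_eq0 xy kE.
  by rewrite gelfandB gelfandM gelfandA subrr normc0.
have [p [disc px pk]] := choquet_peaking gA Chx d0 kx.
have {px} px : 1 - d <= normc (gelfand p x).
  have := normcB (gelfand p x) (gelfand p x - 1); rewrite subKr normc1; lra.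
have near1 w : D * (1 - d) <= D * normc (gelfand p w) ->
    D * normc (1 - gelfand p w) <= D * e.
  rewrite !ler_pM2l// => dw; rewrite -ler_sqr ?nnegrE ?normc_ge0 ?(ltW e0)//.
  apply: le_trans (disc_near1 (ltW d0) (disc w) dw) _.
  by rewrite /d mulrC divfK.
pose g := alpha%:A + (u - alpha)%:A * p.
have gx w : gelfand (1 * g - alpha%:A) w = (u - alpha) * gelfand p w.
  by rewrite mul1r !gelfandE; ring.
have [z [zB zA]] := S_spectrum 1 g.
have zD : D * (1 - d) <= normc z.
  have [_ ->] := zA; apply: le_trans (le_rho gA _ x).
  by rewrite gx normcM ler_wpM2l// ltW.
have zu : normc (u - alpha - z) <= D * e.
  have [x0 _ x0z] := peripheral_attained gA zA.
  rewrite -x0z gx -{1}[u - alpha]mulr1 -mulrBr normcM; apply: near1.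
  by rewrite -normcM -gx x0z.
have [y' Chy' y'z] := peripheral_attained gB zB.
have [x' Chx' x'y'] := matched_right Chy'.
(* [v] is [g(x')], so by [value_determined] the constant [v] can replace [g] at [y']. *)
pose v := alpha + (u - alpha) * gelfand p x'.
have Sg : gelfand (S g) y' = gelfand (S v%:A) y'.
  by apply: (value_determined Chy' x'y'); rewrite !gelfandE.
rewrite gelfandB gelfandM gelfandA Sg in y'z.
(* As [|z|] is nearly [D], this forces [|p(x')|] to be nearly 1, hence [v] to be close to [u]. *)
have zp : normc z <= D * normc (gelfand p x').
  rewrite -y'z {1}S1E; apply: le_trans (const_product_dist y' _ _) _.
  by rewrite -normcM mul1r /v addrAC subrr add0r.
have uv : normc (u - v) <= D * e.
  have -> : u - v = (u - alpha) * (1 - gelfand p x') by rewrite /v; ring.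
  by rewrite normcM; apply: near1; exact: le_trans zD zp.
have Suv : normc (gelfand (S 1) y' * gelfand (S u%:A) y' - (alpha + z)) <= D * e.
  have -> : alpha + z = gelfand (S 1) y' * gelfand (S v%:A) y' by rewrite -y'z; ring.
  rewrite -mulrBr normcM -x'y' gelfand1 normc1 mul1r.
  exact: le_trans (const_lipschitz x'y' _ _) uv.
have kx' : normc (gelfand (S 1) y' * gelfand (S u%:A) y' - c) <= e ^+ 2.
  have -> : gelfand (S 1) y' * gelfand (S u%:A) y' - c = gelfand (S k) y'.
    by rewrite kE !gelfandE.
  have p_half : 2^-1 <= normc (gelfand p x').
    by have := le_trans zD zp; rewrite ler_pM2l//; lra.
  rewrite -x'y'; have := pk k x'; rewrite inE eqxx normcM => /(_ isT).
  have := normc_ge0 (gelfand k x'); rewrite /d.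
  move: (normc (gelfand p x')) (normc (gelfand k x')) p_half => s t ? ? ?; nra.
set s := gelfand (S 1) y' * gelfand (S u%:A) y' in Suv kx'.
(* [alpha + z] is within [D e] of both [u] and [s], and [s] is within [e^2] of [c]. *)
have -> : u - c = (u - alpha - z) - (s - (alpha + z)) + (s - c) by ring.
apply: le_trans (normcD _ _) _; have := normcB (u - alpha - z) (s - (alpha + z)).
have : e ^+ 2 <= e by rewrite expr2 ler_piMr// ltW.
lra.
Qed.

(** Replacing [f] by the constant [f(x)] reduces the claim to [const_value]; for [f = 1] this shows
    that [S 1] squares to 1 at [y], so it can be moved to the other side. *)
Theorem value_formula x y f : Ch (cl A) x -> Ch (cl B) y -> matched x y ->
  gelfand (S f) y = gelfand (S 1) y * gelfand f x.
Proof.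
move=> Chx Chy xy.
have Sf h : gelfand (S 1) y * gelfand (S h) y = gelfand h x.
  rewrite (_ : gelfand (S h) y = gelfand (S (gelfand h x)%:A) y) ?const_value//.
    exact: const_value Chx Chy xy.
  by apply: (value_determined Chy xy); rewrite gelfandA.
by rewrite -[in RHS]Sf mulrA Sf gelfand1 mul1r.
Qed.

End peripherally_multiplicative.

(** * Continuity of the boundary map and the conclusion *)

Section set_of_characters.
Variables (R : realType) (A B : comAlgType R[i]) (P : set (maxspace A)) (Q : set (maxspace B)).

(** Convergence in the Gelfand topology is tested on each transform, so it is enough that every [f]
    composed with [phi] is the restriction of a transform. *)
Lemma continuous_of_gelfand (phi : set_type Q -> set_type P) :
  (forall f, exists b, forall y, gelfand f (set_val (phi y)) = gelfand b (set_val y)) ->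
  continuous phi.
Proof.
move=> phiE y0; have FF : Filter (nbhs y0) by exact: nbhs_filter.
have lim : (set_val \o phi) @ y0 --> set_val (phi y0).
  have Fphi : Filter ((set_val \o phi) @ y0) by exact: fmap_filter.
  apply: cvg_maxspace => f; have [b bE] := phiE f.
  apply/(@cvg_normcP _ _ _ Fphi) => e e0.
  have cb : continuous ((gelfand b : maxspace B -> R[i]^o) \o (set_val : set_type Q -> maxspace B)).
    move=> y; apply: continuous_comp; first exact: initial_continuous.
    exact: gelfand_continuous.
  have := nbhs_normc_continuous y0 cb e0; apply: (@filterS _ _ FF) => y /=.
  by rewrite -!bE.
move=> U [_ [[V oV <-] Vx VU]].
have /lim : nbhs (set_val (phi y0)) V by exact: open_nbhs_nbhs.
by apply: (@filterS _ _ FF) => y Vy; apply: VU.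
Qed.

End set_of_characters.

Theorem corollary7p6 (R : realType) (A B : comBanachAlgType R[i])
    (S : alg_of A -> alg_of B) (alpha : R[i])
    (A_semisimple : semisimple (alg_of A))
    (S_onto : range S = [set: alg_of B])
    (alpha_neq0 : alpha <> 0)
    (S_spectrum : forall f g : alg_of A,
       peripheral_spectrum (S f * S g - alpha%:A) `&`
         peripheral_spectrum (f * g - alpha%:A) !=set0) :
  semisimple (alg_of B) /\
  exists phi : set_type (Ch (cl (alg_of B))) -> set_type (Ch (cl (alg_of A))),
    homeomorphism phi /\
    forall (f : alg_of A) (y : set_type (Ch (cl (alg_of B)))),
      gelfand (S f) (set_val y) =
        gelfand (S 1) (set_val y) * gelfand f (set_val (phi y)).
Proof.
have gA := banach_gelfand_algebra A; have gB := banach_gelfand_algebra B.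
have onto b : exists f, S f = b.
  by have : [set: alg_of B] b by []; rewrite -S_onto => -[f _ <-]; exists f.
have alpha0 : alpha != 0 by exact/eqP.
have right := matched_right gA gB onto S_spectrum.
have left := matched_left gA gB onto S_spectrum.
split.
  apply/semisimpleP => b b0.
  (* Matching preserves moduli, so [f] vanishes on the boundary; then [rho f = 0], and
     semisimplicity of [A] gives [f = 0]. *)
  have zero f : (forall y, gelfand (S f) y = 0) -> f = 0.
    move=> Sf0; have /semisimpleP := A_semisimple; apply => x.
    have [y Chy fy] := rho_attained gA f; have [y' _ yy'] := left _ Chy.
    apply/eqP; rewrite -normc_eq0 eq_le normc_ge0 andbT.
    by apply: le_trans (le_rho gA f x) _; rewrite -fy yy' Sf0 normc0.
  (* Preimages of [b] and of 0 exist and are both 0, so [b = S 0 = 0]. *)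
  have [f fb] := onto b; have [f0 f00] := onto 0.
  have -> : b = S 0 by rewrite -fb (zero f) // => y; rewrite fb.
  by rewrite -f00 (zero f0)// => y; rewrite f00 gelfand0.
pose phi (y : set_type (Ch (cl (alg_of B)))) : set_type (Ch (cl (alg_of A))) :=
  let: exist2 x Chx _ := cid2 (right _ (set_valP y)) in SigSub (mem_set Chx).
have phiP y : matched S (set_val (phi y)) (set_val y).
  by rewrite /phi; case: cid2.
pose psi (x : set_type (Ch (cl (alg_of A)))) : set_type (Ch (cl (alg_of B))) :=
  let: exist2 y Chy _ := cid2 (left _ (set_valP x)) in SigSub (mem_set Chy).
have psiP x : matched S (set_val x) (set_val (psi x)).
  by rewrite /psi; case: cid2.
have formula f y : gelfand (S f) (set_val y) =
    gelfand (S 1) (set_val y) * gelfand f (set_val (phi y)).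
  exact: (value_formula gA gB onto alpha0 S_spectrum) (set_valP (phi y)) (set_valP y) (phiP y).
have phiK : cancel phi psi.
  by move=> y; apply: val_inj; exact: (matched_unique_right onto) (psiP _) (phiP y).
have psiK : cancel psi phi.
  by move=> x; apply: val_inj; exact: matched_unique_left (phiP _) (psiP x).
have S1_neq0 (y : set_type (Ch (cl (alg_of B)))) : gelfand (S 1) (set_val y) != 0.
  by rewrite -normc_eq0 -(phiP y) gelfand1 normc1 oner_eq0.
have S1_sqr (y : set_type (Ch (cl (alg_of B)))) :
    gelfand (S 1) (set_val y) * gelfand (S 1) (set_val y) = 1.
  have := const_value gA gB onto alpha0 S_spectrum 1 (set_valP (phi y)) (set_valP y) (phiP y).
  by rewrite scale1r.
exists phi; split; last exact: formula.
split; last exists psi.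
  (* Since [S 1] squares to 1 on the boundary, [f] composed with [phi] is the restriction of
     [S 1 S f]. *)
  apply: continuous_of_gelfand => f; exists (S 1 * S f) => y.
  by rewrite gelfandM (formula f) mulrA S1_sqr mul1r.
(* For the inverse map, the formula for [k] at [psi x] gives [k(x) = b (psi x)] after cancelling
   [S 1 (psi x)]. *)
split=> //; apply: continuous_of_gelfand => b; have [k kE] := onto (S 1 * b).
exists k => x; have := formula k (psi x); rewrite kE gelfandM psiK.
exact: mulfI.
Qed.
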